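(* Let $V$ be a finite-dimensional vector space over a field $F$ and let $n\ge 1$. Let $\mathcal A_n(V)$ denote the vector space of polynomial $n$-applications $V\to F$ and $\mathcal C_n(V)$ the vector space of characteristic $n$-linear forms $V^n\to F$. Then $$\mathcal A_n(V)=\mathcal P^t_n(V)\cap \mathcal P^{\equiv}_n(V)$$ and, as vector spaces over $F$, $$\mathcal C_n(V)\cong \bigl(\mathcal P^t_n(V)\cap \mathcal P^{\equiv}_n(V)\bigr)/\bigl(\mathcal P_{n-1}(V)\cap \mathcal P^{\equiv}_n(V)\bigr).$$
   Context: $F$ is a field and $V$ is a $d$-dimensional vector space over $F$. Convention: $\mathrm{char}(F)=\infty$ if $F$ contains the rational numbers; otherwise $\mathrm{char}(F)$ is the usual prime characteristic. Polarization: for a map $\alpha:V\to F$ with $\alpha(0)=0$ and $n\ge 1$, the $n$th defect $\Delta^n\alpha:V^n\to F$ is $\Delta^n\alpha(u_1,\dots,u_n)=\sum_{1\le i_1<\cdots<i_m\le n}(-1)^{n-m}\alpha(u_{i_1}+\cdots+u_{i_m})$, the sum being over all nonempty subsets $\{i_1,\dots,i_m\}$ of $\{1,\dots,n\}$. The combinatorial degree $\mathrm{cdeg}(\alpha)$ is the positive integer $n$ with $\Delta^n\alpha\ne 0$ and $\Delta^{n+1}\alpha=0$ (if it exists); $\mathrm{cdeg}(0)=-1$. A symmetric form $f:V^n\to F$ is a map invariant under permutations of its arguments; it is $n$-linear if it is linear in each argument. A symmetric form $\varphi:V^n\to F$ is characteristic if either $n<\mathrm{char}(F)$, or $n\ge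 \mathrm{char}(F)=p$ and $\varphi(u,\dots,u,v_1,\dots,v_{n-p})=0$ ($u$ repeated $p$ times) for all $u,v_1,\dots,v_{n-p}\in V$. Characteristic $n$-linear forms are in particular symmetric. A map $\alpha:V\to F$ is an $n$-application if $\alpha(au)=a^n\alpha(u)$ for all $a\in F$, $u\in V$, and $\Delta^n\alpha$ is a symmetric $n$-linear form. A polynomial in $F[x_1,\dots,x_d]$ is reduced if every exponent of every variable in every monomial occurring with nonzero coefficient is less than $|F|$ (no condition if $F$ is infinite). A map $\alpha:V\to F$ is a polynomial mapping if for a basis $e_1,\dots,e_d$ there is $f\in F[x_1,\dots,x_d]$ with $\alpha(\sum a_ie_i)=f(a_1,\dots,a_d)$ for all $a_i\in F$; $f$ is said to realize $\alpha$, and there is a unique reduced $f$ realizing $\alpha$ with respect to the given basis. A monomial of $\alpha$ (with respect to the basis) is a polynomial mapping $\beta$ realized by a monomial (with its nonzero coefficient) of the reduced polynomial $f$ realizing $\alpha$; $\deg(\beta)$ is the total degree of that reduced monomial, and $\beta$ is totally reduced if all exponents of that monomial are less than $\mathrm{char}(F)$. A polynomial $n$-application is an $n$-application that is a polynomial mapping. The following are subspaces of the space of polynomial mappings $V\to F$ (the conditions are with respect to one, equivalently any, basis of $V$): $\mathcal P_n(V)=\{\alpha:\ \mathrm{cdeg}(\alpha)\le n,\ \alpha(0)=0\}$; $\mathcal P^t_n(V)=\{\alpha\in\mathcal P_n(V):$ all monomials $\beta$ of $\alpha$ with $\mathrm{cdeg}(\beta)=n$ are totally reduced$\}$; $\mathcal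 P^{\equiv}_n(V)=\{\alpha:$ all monomials $\beta$ of $\alpha$ satisfy $0\ne\deg(\beta)\equiv n \pmod{|F|-1}\}$, where for infinite $F$ the congruence modulo $|F|-1$ means equality. *)

(* Defs.v *)
From HB Require Import structures.
From mathcomp Require Import all_boot all_order perm all_algebra.
From mathcomp Require Import mpoly.
From mathcomp Require Import boolp classical_sets functions cardinality.

Set Implicit Arguments.
Unset Strict Implicit.
Unset Printing Implicit Defensive.

Import GRing.Theory.
Local Open Scope classical_set_scope.
Local Open Scope card_scope.
Local Open Scope ring_scope.


Section Subspaces.
Variables (F : fieldType) (E : lmodType F).

Record subspace := Subspace {
  subspace_set :> set E;
  subspace0 : subspace_set 0;
  subspaceP : forall (a : F) (x y : E),
    subspace_set x -> subspace_set y -> subspace_set (a *: x + y) }.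

Lemma subspaceI_subproof (W U : subspace) (a : F) (x y : E) :
  (W `&` U) x -> (W `&` U) y -> (W `&` U) (a *: x + y).
Proof. by move=> [? ?] [? ?]; split; apply: subspaceP. Qed.

Definition subspaceI (W U : subspace) : subspace :=
  Subspace (conj (subspace0 W) (subspace0 U)) (@subspaceI_subproof W U).

Definition subspace_pred (W : subspace) : {pred E} := fun x => `[< subspace_set W x >].

Lemma subspace_pred_closed (W : subspace) :
  GRing.subsemimod_closed (subspace_pred W).
Proof.
split; last first.
  move=> a x /asboolP Wx; apply/asboolP.
  by rewrite -[_ *: _]addr0; apply: subspaceP => //; apply: subspace0.
split; first by apply/asboolP; apply: subspace0.
move=> x y /asboolP Wx /asboolP Wy; apply/asboolP.
by rewrite -[x]scale1r; apply: subspaceP.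
Qed.

HB.instance Definition _ (W : subspace) :=
  GRing.isSubmodClosed.Build F E (subspace_pred W) (subspace_pred_closed W).

Record subspace_type (W : subspace) := SubspaceElt {
  subspace_val :> E;
  subspace_valP : subspace_val \in subspace_pred W }.

HB.instance Definition _ (W : subspace) := [isSub for @subspace_val W].
HB.instance Definition _ (W : subspace) := [Choice of subspace_type W by <:].
HB.instance Definition _ (W : subspace) :=
  [SubChoice_isSubZmodule of subspace_type W by <:].
HB.instance Definition _ (W : subspace) :=
  [SubZmodule_isSubLmodule of subspace_type W by <:].

End Subspaces.

Section QuotientSpace.
Local Open Scope quotient_scope.
Variables (F : fieldType) (E : lmodType F) (W U : subspace E).

Definition rel_pred : {pred subspace_type W} :=
  fun x => \val x \in subspace_pred U.

Lemma rel_pred_closed : GRing.subsemimod_closed rel_pred.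
Proof.
have inE x : (x \in rel_pred) = (\val x \in subspace_pred U) by [].
split; last by move=> a x; rewrite !inE GRing.valZ; apply: rpredZ.
split; first by rewrite inE GRing.val0 rpred0.
by move=> x y; rewrite !inE GRing.valD; apply: rpredD.
Qed.

HB.instance Definition _ := GRing.isSubmodClosed.Build F _ rel_pred rel_pred_closed.

(* This is W / (W `&` U), hence the usual W / U as soon as U `<=` W. *)
Definition quotient_space := Quotient.quot rel_pred.

HB.instance Definition _ := GRing.Zmodule.on quotient_space.
HB.instance Definition _ : EqQuotient _ (Quotient.equiv rel_pred) quotient_space
  := EqQuotient.on quotient_space.

Let scale (a : F) (x : quotient_space) : quotient_space :=
  \pi_(quotient_space) (a *: repr x).

Let eqmodP (x y : subspace_type W) :
  reflect (\pi_(quotient_space) x = \pi_(quotient_space) y) (x - y \in rel_pred).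
Proof. by rewrite (Quotient.idealrBE rel_pred x y); apply: eqP. Qed.

Let pi_add x y :
  \pi_(quotient_space) (x + y) = \pi_(quotient_space) x + \pi_(quotient_space) y.
Proof. by rewrite !piE. Qed.

Let pi_scale a x : scale a (\pi_(quotient_space) x) = \pi_(quotient_space) (a *: x).
Proof.
apply/eqmodP; rewrite -scalerBr; apply: rpredZ; apply/eqmodP; exact: reprK.
Qed.

Let scaleA a b x : scale a (scale b x) = scale (a * b) x.
Proof. by elim/quotW: x => x; rewrite (pi_scale b x) !pi_scale scalerA. Qed.

Let scale1 : left_id 1 scale.
Proof. by elim/quotW=> x; rewrite pi_scale scale1r. Qed.

Let scaleDr : right_distributive scale +%R.
Proof.
move=> a; elim/quotW=> x; elim/quotW=> y.
by rewrite -pi_add !pi_scale -pi_add scalerDr.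
Qed.

Let scaleDl x : {morph scale^~ x : a b / a + b}.
Proof. by elim/quotW: x => x a b; rewrite !pi_scale -pi_add scalerDl. Qed.

HB.instance Definition _ := GRing.Zmodule_isLmodule.Build F quotient_space
  scaleA scale1 scaleDr scaleDl.

Lemma pi_quotient_spaceZ (a : F) (x : subspace_type W) :
  \pi_(quotient_space) (a *: x) = a *: \pi_(quotient_space) x.
Proof. by rewrite -pi_scale. Qed.

End QuotientSpace.

Section Defect.
Variables (F : fieldType) (V : vectType F).
Implicit Types alpha beta : V -> F.

(* A subset I encodes i_1 < ... < i_m; since #|I| <= n, the natural-number
   subtraction in the exponent is not truncated. *)
Definition defect (n : nat) alpha (u : {ffun 'I_n -> V}) : F :=
  \sum_(I : {set 'I_n} | I != finset.set0)
    (-1) ^+ (n - #|I|) * alpha (\sum_(i in I) u i).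

(* The combinatorial degree is a relation because it need not exist. *)
Definition has_cdeg alpha (k : int) : Prop :=
  (alpha = (fun=> 0) /\ k = -1) \/
  (exists n : nat, [/\ (0 < n)%N, k = n%:Z, @defect n alpha <> (fun=> 0)
                     & @defect n.+1 alpha = (fun=> 0)]).

Definition cdeg_le alpha (n : nat) : Prop :=
  exists2 k : int, has_cdeg alpha k & k <= n%:Z.

Let defectx n alpha (x : V) (u : {ffun 'I_n -> V}) : F :=
  \sum_(I : {set 'I_n}) (-1) ^+ (n - #|I|) * alpha (x + \sum_(i in I) u i).

Let tail n (u : {ffun 'I_n.+1 -> V}) : {ffun 'I_n -> V} :=
  [ffun i => u (lift ord0 i)].

Let cons n (x : V) (u : {ffun 'I_n -> V}) : {ffun 'I_n.+1 -> V} :=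
  [ffun i => if unlift ord0 i is Some j then u j else x].

Let tail_cons n x (u : {ffun 'I_n -> V}) : tail (cons x u) = u.
Proof. by apply/ffunP => i; rewrite !ffunE liftK. Qed.

Let cons0 n x (u : {ffun 'I_n -> V}) : cons x u ord0 = x.
Proof. by rewrite ffunE unlift_none. Qed.

Let defectx0 n alpha (u : {ffun 'I_n -> V}) :
  alpha 0 = 0 -> defectx alpha 0 u = defect alpha u.
Proof.
move=> a0; rewrite /defectx /defect (bigD1 finset.set0) //= big_set0 addr0 a0.
by rewrite mulr0 add0r; apply: eq_bigr => I _; rewrite add0r.
Qed.

Let defectxS n alpha x (u : {ffun 'I_n.+1 -> V}) :
  defectx alpha x u
  = defectx alpha (x + u ord0) (tail u) - defectx alpha x (tail u).
Proof.
pose h (J : {set 'I_n}) := (lift ord0 @: J)%SET.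
pose k (I : {set 'I_n.+1}) := (lift ord0 @^-1: I)%SET.
have h0 J : ord0 \notin h J.
  by apply/imsetP => -[j _] /eqP; rewrite (negbTE (neq_lift _ _)).
have liftI : injective (@lift n.+1 ord0) by apply: lift_inj.
have hk (I : {set _}) : ord0 \notin I -> h (k I) = I.
  move=> I0; apply/setP => i; case: (unliftP ord0 i) => [j|] ->.
    by rewrite mem_imset // inE.
  by rewrite (negbTE (h0 _)) (negbTE I0).
have kh J : k (h J) = J by apply/setP => j; rewrite inE mem_imset.
have hs J : \sum_(i in h J) u i = \sum_(i in J) tail u i.
  rewrite big_imset /=; last by move=> i j _ _; apply: liftI.
  by apply: eq_bigr => i _; rewrite ffunE.
have hc J : #|h J| = #|J| by rewrite card_imset.
rewrite /defectx (bigID (fun I : {set 'I_n.+1} => ord0 \in I)) /=; congr (_ + _).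
  rewrite (reindex_onto (fun J => ord0 |: h J)%SET k) /=; last first.
    move=> I I0; apply/setP => i; case: (unliftP ord0 i) => [j|] ->.
      by rewrite !inE eq_sym (negbTE (neq_lift _ _)) mem_imset // inE.
    by rewrite !inE eqxx I0.
  apply: eq_big => [J|J _].
    rewrite setU11 /=; apply/eqP/setP => j.
    by rewrite !inE eq_sym (negbTE (neq_lift _ _)) mem_imset.
  by rewrite cardsU1 h0 hc subSS big_setU1 // hs addrA.
rewrite (reindex_onto h k) /=; last by move=> I; apply: hk.
rewrite -sumrN; apply: eq_big => [J|J _]; first by rewrite h0 kh eqxx.
rewrite hc hs subSn; first by rewrite exprS mulN1r mulNr.
by rewrite -[X in (_ <= X)%N]card_ord max_card.
Qed.

Lemma defect_eq0S n alpha : alpha 0 = 0 ->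
  (forall u : {ffun 'I_n.+1 -> V}, defect alpha u = 0) ->
  forall u : {ffun 'I_n.+2 -> V}, defect alpha u = 0.
Proof.
move=> a0 an u.
have an0 x (v : {ffun 'I_n -> V}) : defectx alpha x v = defectx alpha 0 v.
  have := an (cons x v); rewrite -defectx0 // defectxS tail_cons cons0 add0r.
  by move/eqP; rewrite subr_eq0 => /eqP.
rewrite -defectx0 // defectxS add0r defectxS [X in _ - X]defectxS.
by rewrite !(an0 _ (tail (tail u))) !subrr.
Qed.

Lemma cdeg_leP n alpha : alpha 0 = 0 ->
  cdeg_le alpha n <-> (forall u : {ffun 'I_n.+1 -> V}, defect alpha u = 0).
Proof.
move=> a0; split.
  case=> k [[-> _] _ u|].
    by rewrite /defect big1 // => I _; rewrite mulr0.
  case=> m [m0 -> _ dm]; rewrite lez_nat => mn.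
  have dm' (u : {ffun 'I_m.+1 -> V}) : defect alpha u = 0 by rewrite dm.
  rewrite -(subnK mn); elim: (n - m)%N => // l IHl u.
  exact: (defect_eq0S a0 IHl).
move=> dn; have [->|an0] := pselect (alpha = fun=> 0).
  by exists (-1) => //; left.
elim: n dn => [|n IHn] dn.
  case: an0; apply/funext => x.
  have := dn (cons x [ffun=> 0]); rewrite -defectx0 // defectxS cons0 add0r.
  rewrite /defectx !(big_pred1 finset.set0) ?big_set0 ?addr0.
  - by rewrite cards0 subn0 expr0 !mul1r a0 subr0.
  - by move=> I; apply/esym/eqP/setP => -[].
  - by move=> I; apply/esym/eqP/setP => -[].
have [dn'|] := pselect (forall u : {ffun 'I_n.+1 -> V}, defect alpha u = 0).
  have [k ck kn] := IHn dn'; exists k => //.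
  by apply: (Order.POrderTheory.le_trans kn); rewrite lez_nat.
move=> ndn; exists n.+1%:Z => //; right; exists n.+1; split=> //.
  by move=> E; apply: ndn => u; rewrite E.
by apply/funext => u; rewrite dn.
Qed.

Lemma defect_lin n (a : F) (alpha beta : V -> F^o) (u : {ffun 'I_n -> V}) :
  defect (a *: alpha + beta) u = a * defect alpha u + defect beta u.
Proof.
rewrite /defect mulr_sumr -big_split /=; apply: eq_bigr => I _.
by rewrite mulrDr mulrCA.
Qed.

Lemma has_cdegZ (a : F) (alpha : V -> F^o) (k : int) :
  a != 0 -> has_cdeg alpha k -> has_cdeg (a *: alpha) k.
Proof.
move=> a0; have dE n (u : {ffun 'I_n -> V}) :
    defect (a *: alpha) u = a * defect alpha u.
  by rewrite -[a *: alpha]addr0 defect_lin /defect [X in _ + X]big1 ?addr0 // =>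
    I _; rewrite mulr0.
case=> [[-> ->]|[n [n0 -> dn dn1]]].
  by left; split=> //; apply/funext => x; rewrite /= [LHS]mulr0.
right; exists n; split=> //; last by apply/funext => u; rewrite dE dn1 mulr0.
move=> E; apply: dn; apply/funext => u; apply/eqP.
by have /eqP := congr1 (@^~ u) E; rewrite dE mulf_eq0 (negbTE a0).
Qed.

End Defect.

Section Forms.
Variables (F : fieldType) (V : vectType F) (n : nat).
Implicit Types phi : {ffun 'I_n -> V} -> F.

Definition symmetric_form phi : Prop :=
  forall (s : 'S_n) (u : {ffun 'I_n -> V}), phi [ffun i => u (s i)] = phi u.

Definition multilinear_form phi : Prop :=
  forall (i : 'I_n) (u : {ffun 'I_n -> V}) (a : F) (x y : V),
    let upd z := [ffun j => if j == i then z else u j] in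
    phi (upd (a *: x + y)) = a * phi (upd x) + phi (upd y).

(* [pchar F] is empty when F contains the rationals, which encodes
   char(F) = oo.  Only the values of v at indices >= p matter below: they are
   v_1, ..., v_(n-p). *)
Definition characteristic_form phi : Prop :=
  (forall p : nat, p \in [pchar F] -> (n < p)%N) \/
  (exists p : nat, [/\ p \in [pchar F], (p <= n)%N
    & forall (u : V) (v : 'I_n -> V),
        phi [ffun i : 'I_n => if (i < p)%N then u else v i] = 0]).

Definition characteristic_nlinear : set ({ffun 'I_n -> V} -> F^o) :=
  [set phi | [/\ symmetric_form phi, multilinear_form phi
               & characteristic_form phi]].

Lemma characteristic_formP phi : characteristic_form phi <->
  (forall p : nat, p \in [pchar F] -> (p <= n)%N ->
    forall (u : V) (v : 'I_n -> V),
      phi [ffun i : 'I_n => if (i < p)%N then u else v i] = 0).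
Proof.
split.
  case=> [lt_np p /lt_np|[q [qF _ phi0]] p pF _]; first by rewrite ltnNge => /negbTE->.
  by move: pF; rewrite (pcharf_eq qF) inE => /eqP ->.
move=> phi0; have [[p [pF pn]]|npn] := pselect (exists p, p \in [pchar F] /\ (p <= n)%N).
  by right; exists p; split=> //; apply: phi0.
by left=> p pF; rewrite ltnNge; apply/negP => pn; apply: npn; exists p.
Qed.

Lemma characteristic_nlinear0 : characteristic_nlinear 0.
Proof.
split=> //; last by apply/characteristic_formP.
by move=> i u a x y upd; rewrite /= [RHS]addr0 mulr0.
Qed.

Lemma characteristic_nlinearP (a : F) (phi psi : {ffun 'I_n -> V} -> F^o) :
  characteristic_nlinear phi -> characteristic_nlinear psi ->
  characteristic_nlinear (a *: phi + psi).
Proof.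
move=> [phis phil /characteristic_formP phic].
move=> [psis psil /characteristic_formP psic].
have E u : (a *: phi + psi) u = a * phi u + psi u by [].
split.
- by move=> s u; rewrite !E phis psis.
- move=> i u b x y upd; rewrite !E phil psil /=.
  by rewrite !mulrDr addrACA !(mulrCA b).
- by apply/characteristic_formP => p pF pn u v; rewrite E phic // psic // mulr0 addr0.
Qed.

Definition C_ : subspace ({ffun 'I_n -> V} -> F^o) :=
  Subspace characteristic_nlinear0 characteristic_nlinearP.

End Forms.
Arguments C_ {F} V n.

Section PolynomialMappings.
Variables (F : fieldType) (V : vectType F).
Local Notation d := (\dim (fullv : {vspace V})).
Implicit Types (e : d.-tuple V) (alpha beta : V -> F) (f : {mpoly F[d]}).

Definition realizes e f alpha : Prop :=
  forall a : 'I_d -> F, alpha (\sum_(i < d) a i *: e`_i) = f.@[a].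

Definition polynomial_mapping alpha : Prop :=
  exists e, basis_of fullv e /\ exists f, realizes e f alpha.

Definition reduced f : Prop :=
  forall q : nat, [set: F] #= `I_q ->
    forall m, m \in msupp f -> forall i : 'I_d, (m i < q)%N.

(* [all_monomials e alpha Q]: alpha is realized by a reduced polynomial f
   (which is unique when e is a basis), and Q m beta holds for every monomial
   beta of alpha, where m is the exponent of the monomial of f realizing beta. *)
Definition all_monomials e alpha (Q : 'X_{1..d} -> (V -> F) -> Prop) : Prop :=
  exists f, [/\ reduced f, realizes e f alpha
    & forall m beta, m \in msupp f -> realizes e (f@_m *: 'X_[m]) beta ->
        Q m beta].

Definition totally_reduced (m : 'X_{1..d}) : Prop :=
  forall p : nat, p \in [pchar F] -> forall i : 'I_d, (m i < p)%N.

Definition eqmod_card_minus1 (k n : nat) : Prop :=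
  (forall q : nat, [set: F] #= `I_q -> (k = n %[mod q.-1])%N) /\
  (infinite_set [set: F] -> k = n).

Definition n_application (n : nat) alpha : Prop :=
  [/\ forall (a : F) (u : V), alpha (a *: u) = a ^+ n * alpha u,
      symmetric_form (@defect _ _ n alpha)
    & multilinear_form (@defect _ _ n alpha)].

Definition A_ (n : nat) : set (V -> F^o) :=
  [set alpha | n_application n alpha /\ polynomial_mapping alpha].

Definition P_set (n : nat) : set (V -> F^o) :=
  [set alpha | [/\ polynomial_mapping alpha, cdeg_le alpha n & alpha 0 = 0]].

Definition Pt_set e (n : nat) : set (V -> F^o) :=
  [set alpha | P_set n alpha /\
    all_monomials e alpha (fun m beta => has_cdeg beta n -> totally_reduced m)].

Definition Pequiv_set e (n : nat) : set (V -> F^o) :=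
  [set alpha | all_monomials e alpha
    (fun m _ => mdeg m <> 0%N /\ eqmod_card_minus1 (mdeg m) n)].

Lemma polynomial_mappingP e alpha : basis_of fullv e ->
  polynomial_mapping alpha <-> exists f, realizes e f alpha.
Proof.
move=> eb; split=> [[e' [e'b [f fa]]]|]; last by exists e.
pose l := [tuple \sum_(i < d) coord e' j e`_i *: 'X_i : {mpoly F[d]} | j < d].
exists (f \mPo l) => a; rewrite comp_mpoly_meval -[RHS]/(meval _ f).
have -> : \sum_(i < d) a i *: e`_i
    = \sum_(j < d) (tnth l j).@[a] *: e'`_j.
  rewrite [LHS](coord_basis e'b) ?memvf //; apply: eq_bigr => j _; congr (_ *: _).
  rewrite tnth_mktuple raddf_sum linear_sum /=; apply: eq_bigr => i _.
  by rewrite linearZ mevalZ mevalXU mulrC.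
exact: fa.
Qed.

Lemma realizes_lin e f g (a : F) (alpha beta : V -> F^o) :
  realizes e f alpha -> realizes e g beta ->
  realizes e (a *: f + g) (a *: alpha + beta).
Proof. by move=> fa gb x; rewrite mevalD mevalZ -fa -gb. Qed.

Lemma realizes0 e : realizes e 0 (0 : V -> F^o).
Proof. by move=> x; rewrite meval0. Qed.

Lemma polynomial_mapping_lin (a : F) (alpha beta : V -> F^o) :
  polynomial_mapping alpha -> polynomial_mapping beta ->
  polynomial_mapping (a *: alpha + beta).
Proof.
have eb : basis_of fullv (vbasis (fullv : {vspace V})) by apply: vbasisP.
move=> /(polynomial_mappingP _ eb)[f fa] /(polynomial_mappingP _ eb)[g gb].
by apply/(polynomial_mappingP _ eb); exists (a *: f + g); apply: realizes_lin.
Qed.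

Lemma msupp_lin (a : F) f g m :
  m \in msupp (a *: f + g) -> m \in msupp f \/ m \in msupp g.
Proof.
move=> /msuppD_le; rewrite mem_cat => /orP[/msuppZ_le|]; first by left.
by right.
Qed.

Lemma all_monomials_lin e (Q : 'X_{1..d} -> (V -> F) -> Prop) (a : F)
    (alpha beta : V -> F^o) :
  (forall m (c : F) (gamma : V -> F^o), c != 0 ->
     Q m (c *: gamma) -> Q m gamma) ->
  all_monomials e alpha Q -> all_monomials e beta Q ->
  all_monomials e (a *: alpha + beta) Q.
Proof.
move=> QZ [f [fr fa fQ]] [g [gr gb gQ]]; exists (a *: f + g).
have step h m gamma : m \in msupp h -> m \in msupp (a *: f + g) ->
    (forall m beta, m \in msupp h -> realizes e (h@_m *: 'X_[m]) beta ->
      Q m beta) ->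
    realizes e ((a *: f + g)@_m *: 'X_[m]) gamma -> Q m gamma.
  move=> mh mfg hQ rg; pose c := h@_m / (a *: f + g)@_m.
  rewrite !mcoeff_msupp in mh mfg.
  apply: (QZ m c); first by rewrite mulf_neq0 ?invr_eq0.
  apply: hQ; first by rewrite mcoeff_msupp.
  move=> x; rewrite [LHS](_ : _ = c * gamma (\sum_(i < d) x i *: e`_i)) //.
  by rewrite rg !mevalZ mulrA divfK.
split.
- by move=> q qF m /msupp_lin[]; [apply: fr | apply: gr].
- exact: realizes_lin.
- move=> m gamma mfg; case: (msupp_lin mfg) => mh.
    exact: step mh mfg fQ.
  exact: step mh mfg gQ.
Qed.

Lemma all_monomials0 e Q : all_monomials e (0 : V -> F^o) Q.
Proof.
exists 0; split=> [q _ m|  |m beta]; rewrite ?msupp0 //; exact: realizes0.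
Qed.

Lemma P_set0 n : P_set n 0.
Proof.
split=> //; last by exists (-1) => //; left.
exists (vbasis fullv); split; first exact: vbasisP.
by exists 0; apply: realizes0.
Qed.

Lemma P_setP n (a : F) (alpha beta : V -> F^o) :
  P_set n alpha -> P_set n beta -> P_set n (a *: alpha + beta).
Proof.
move=> [pa ca a0] [pb cb b0].
have ab0 : (a *: alpha + beta) 0 = 0.
  by rewrite [LHS](_ : _ = a * alpha 0 + beta 0) // a0 b0 mulr0 addr0.
split=> //; first exact: polynomial_mapping_lin.
apply/cdeg_leP => // u; rewrite defect_lin.
by rewrite (proj1 (cdeg_leP n a0) ca) (proj1 (cdeg_leP n b0) cb) mulr0 addr0.
Qed.

Lemma Pt_set0 e n : Pt_set e n 0.
Proof. by split; [apply: P_set0 | apply: all_monomials0]. Qed.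

Lemma Pt_setP e n (a : F) (alpha beta : V -> F^o) :
  Pt_set e n alpha -> Pt_set e n beta -> Pt_set e n (a *: alpha + beta).
Proof.
move=> [Pa ma] [Pb mb]; split; first exact: P_setP.
apply: all_monomials_lin ma mb => m c gamma c0 Qc cg.
exact/Qc/has_cdegZ.
Qed.

Lemma Pequiv_set0 e n : Pequiv_set e n 0.
Proof. exact: all_monomials0. Qed.

Lemma Pequiv_setP e n (a : F) (alpha beta : V -> F^o) :
  Pequiv_set e n alpha -> Pequiv_set e n beta ->
  Pequiv_set e n (a *: alpha + beta).
Proof. exact: all_monomials_lin. Qed.

Definition P_ n : subspace (V -> F^o) := Subspace (P_set0 n) (@P_setP n).

Definition Pt_ e n : subspace (V -> F^o) :=
  Subspace (Pt_set0 e n) (@Pt_setP e n).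

Definition Pequiv_ e n : subspace (V -> F^o) :=
  Subspace (Pequiv_set0 e n) (@Pequiv_setP e n).

End PolynomialMappings.
Arguments A_ {F} V n.
Arguments P_ {F} V n.

(* Main.v *)
Require Import Defs.
From HB Require Import structures.
From mathcomp Require Import boolp classical_sets functions cardinality.
From mathcomp Require Import all_boot all_fingroup all_algebra pgroup.
From mathcomp Require Import finmap mpoly.

(** The proof works with single monomials and never computes their
    combinatorial degrees in terms of base p digits.

    Passing to monomials.  Let [f] be a reduced polynomial realizing [alpha].
    Composing [alpha] with the diagonal map [diag e t] multiplies the monomial
    of exponent [m] by [t^m], and the functions [t |-> t^m], for [t] ranging over
    all of [F^d], zero coordinates included, are linearly independent when the
    exponents are reduced ([reduced_indep]).  Hence every linear condition that
    holds for all the maps [alpha \o diag e t] holds for each monomial of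
    [alpha] ([reduced_monomial_transfer]).  Vanishing of the nth defect,
    multilinearity of the nth defect and homogeneity are such conditions.

    Monomials.  The Nth defect of a product of n coordinates is the sum, over
    the surjections from the n factors onto the N arguments, of the products of
    the values of the factors ([defect_coord_prod]).  For n < N it vanishes; for
    n = N it is multilinear, and at the basis vectors matching the factors it is
    the order of the stabilizer in S_n of the sequence of factors.  By Cauchy's
    theorem this order is nonzero in [F] as soon as all exponents are less than
    the characteristic, so a totally reduced monomial has combinatorial degree
    equal to its degree ([totally_reduced_mdeg]).  Conversely, let the nth
    defect B of a reduced monomial of exponent [m] <> 0 be multilinear and nonzero.
    Then B is nonzero at some basis vectors [e_(r 0), ..., e_(r n.-1)], and
    scaling the coordinates by [t] shows that [t^m] and [t_(r 0) ... t_(r n.-1)]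
    are the same function of [t].  In characteristic p a defect vanishes when p
    of its arguments coincide ([defect_pchar_vanish]), so each index is repeated
    less than p times in [r].  Both exponents are thus reduced, hence equal, and
    the monomial is totally reduced of degree n ([multilinear_monomial]).

    These facts give the description of the polynomial n-applications.  For the
    isomorphism, the nth defect of an n-application is a characteristic form,
    and it vanishes exactly on the maps of combinatorial degree at most n - 1.
    A characteristic form [phi] is the defect of [depolarize e phi], the
    polynomial whose coefficient at each monomial of degree n is the value of
    [phi] at the matching basis vectors divided by the order of the stabilizer;
    where that order is zero in [F], some basis vector is repeated p times and
    the value of [phi] is zero too. *)

Set Implicit Arguments.
Unset Strict Implicit.
Unset Printing Implicit Defensive.

Import GRing.Theory.
Local Open Scope ring_scope.

(** * Power functions on a field *)

Section PowerFunctions.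
Variable F : fieldType.
Local Notation cardF q := ([set: F]%classic #= `I_q)%card.

Lemma card_field_enum q : cardF q ->
  exists s : seq F, [/\ uniq s, size s = q & forall x, x \in s].
Proof.
move=> Fq; have /finite_seqP[s sT] : finite_set [set: F]%classic by exists q.
exists (undup s); rewrite undup_uniq; split=> //; last first.
  by move=> x; rewrite mem_undup; have : [set: F]%classic x by []; rewrite sT.
pose S := seq_fset tt s.
have ST : [set: F]%classic = [set` S]%classic.
  by rewrite sT; apply/seteqP; split=> x /=; rewrite seq_fsetE.
by move: Fq; rewrite ST => /card_eq_fsetP <-; rewrite size_seq_fset.
Qed.

Lemma field_seq_gt1 (s : seq F) : (forall x, x \in s) -> (1 < size s)%N.
Proof.
move=> sT; apply: (@uniq_leq_size _ [:: 0; 1] s) => //.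
by rewrite /= inE eq_sym oner_eq0.
Qed.

Lemma field_card_gt1 q : cardF q -> (1 < q)%N.
Proof. by move=> /card_field_enum[s [_ <- sT]]; apply: field_seq_gt1. Qed.

(** A nonzero polynomial has fewer roots than its size, and the elements of [F]
    provide more roots than the bound on the size allows. *)
Lemma poly_vanish_eq0 (p : {poly F}) :
  (forall q, cardF q -> (size p <= q)%N) -> (forall a, p.[a] = 0) -> p = 0.
Proof.
move=> pq p0; apply/eqP/negPn/negP => pN0.
have ge (s : seq F) : uniq s -> (size s < size p)%N.
  by apply: max_poly_roots => //; apply/allP => x _; apply/rootP.
have [[q Fq]|Finf] := pselect (finite_set [set: F]%classic).
  have [s [us sq _]] := card_field_enum Fq.
  by have := ge s us; rewrite sq ltnNge pq.
have [S _ sS] := infinite_set_fset (size p) Finf.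
have := ge _ (fset_uniq S); by rewrite ltnNge sS.
Qed.

(** Multiplication by [a] permutes the nonzero elements of [F], so it preserves
    their product. *)
Lemma fermat_field q (a : F) : cardF q -> a != 0 -> a ^+ q.-1 = 1.
Proof.
move=> /card_field_enum[s [us sq sT]] a0.
pose t := [seq x <- s | x != 0].
have tE x : (x \in t) = (x != 0) by rewrite mem_filter sT andbT.
have ts : size t = q.-1.
  by rewrite size_filter -sq -(count_predC (pred1 0) s) count_uniq_mem // sT.
have tt : perm_eq [seq a * x | x <- t] t.
  apply: uniq_perm; rewrite ?filter_uniq //.
    by rewrite map_inj_uniq ?filter_uniq //; apply: mulfI.
  move=> x; apply/mapP/idP => [[y yt ->]|].
    by move: yt; rewrite !tE mulf_eq0 negb_or a0.
  rewrite tE => x0; exists (a^-1 * x); last by rewrite mulVKf.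
  by rewrite tE mulf_neq0 ?invr_eq0.
have t0 : \prod_(x <- t) x != 0.
  by rewrite prodf_seq_neq0; apply/allP => x; rewrite tE.
have: \prod_(x <- [seq a * x | x <- t]) x = \prod_(x <- t) x by apply: perm_big.
rewrite big_map big_split /= big_const_seq count_predT ts iter_mulr_1.
by rewrite -[RHS]mul1r => /mulIf; apply.
Qed.

Lemma exp_modn_field q (a : F) k : cardF q -> a != 0 ->
  a ^+ (k %% q.-1) = a ^+ k.
Proof.
move=> Fq a0; rewrite [in RHS](divn_eq k q.-1) exprD mulnC exprM.
by rewrite (fermat_field Fq) // expr1n mul1r.
Qed.

(** Two powers that agree on [F] differ by a polynomial vanishing on [F]; bounds
    on the exponents turn this into equality of exponents. *)
Lemma exp_eq_reduced k l :
  (forall q, cardF q -> (k < q)%N && (l < q)%N) ->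
  (forall a : F, a ^+ k = a ^+ l) -> k = l.
Proof.
move=> klq akl; have p0 : 'X^k - 'X^l = 0 :> {poly F}.
  apply: poly_vanish_eq0 => [q Fq|a]; last first.
    by rewrite !hornerE akl subrr.
  have /andP[kq lq] := klq _ Fq.
  rewrite (leq_trans (size_polyD _ _)) // size_polyN !size_polyXn.
  by rewrite geq_max kq lq.
have /(congr1 (fun p : {poly F} => p`_k)) := p0.
rewrite coefB coef0 !coefXn eqxx /=; case: eqP => // _ /eqP.
by rewrite subr0 oner_eq0.
Qed.

(** The congruence of degrees modulo [|F| - 1] is used only through the power
    functions.  The value at [0] is what distinguishes exponent [0] from
    exponent [q.-1], hence the two conditions of positivity. *)
Lemma eqmod_exp k l : k != 0%N -> l != 0%N ->
  eqmod_card_minus1 F k l <-> (forall a : F, a ^+ k = a ^+ l).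
Proof.
move=> k0 l0; split=> [[fin inf] a|akl].
  have [->|a0] := eqVneq a 0; first by rewrite !expr0n (negbTE k0) (negbTE l0).
  have [[q Fq]|/inf-> //] := pselect (finite_set [set: F]%classic).
  by rewrite -(exp_modn_field k Fq) // (fin _ Fq) exp_modn_field.
split=> [q Fq|Finf]; last first.
  by apply: exp_eq_reduced akl => q Fq; case: Finf; exists q.
apply: succn_inj; apply: exp_eq_reduced.
  move=> q' Fq'; have <- : q = q'.
    by apply/card_eq_II; rewrite (card_eq_trans _ Fq') // card_eq_sym.
  have q1 := field_card_gt1 Fq.
  have q0 : (0 < q.-1)%N by case: q q1 {Fq} => [|[]].
  have := ltn_pmod k q0; have := ltn_pmod l q0.
  by case: q q1 {Fq q0} => // q _ /= *; rewrite !ltnS; apply/andP.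
move=> a; have [->|a0] := eqVneq a 0; first by rewrite !expr0n.
by rewrite !exprS !exp_modn_field // akl.
Qed.

(** The images of 0, ..., k in [F] are distinct when k is less than the
    characteristic.  In characteristic zero the hypothesis holds for every k,
    and the conclusion rules out finite fields. *)
Lemma lt_pchar_lt_card k q :
  (forall p, p \in [pchar F] -> (k < p)%N) -> cardF q -> (k < q)%N.
Proof.
move=> kF /card_field_enum[s [_ <- sT]].
have: uniq [seq i%:R : F | i <- iota 0 k.+1].
  rewrite map_inj_in_uniq ?iota_uniq // => i j; rewrite !mem_iota !add0n /= !ltnS.
  wlog ij : i j / (i <= j)%N => [W|] ik jk E.
    by case/orP: (leq_total i j) => ?; [|symmetry]; apply: W.
  case: ltngtP ij => // ij _; have ji : (0 < j - i)%N by rewrite subn_gt0.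
  have ji0 : (j - i)%:R == 0 :> F by rewrite natrB ?(ltnW ij) // E subrr.
  have [p pF] := natf0_pchar ji ji0.
  have := dvdn_leq ji (etrans (dvdn_pcharf pF _) ji0).
  by rewrite leqNgt (leq_ltn_trans (leq_subr _ _)) // (leq_ltn_trans jk) // kF.
by move/uniq_leq_size => /(_ s (fun x _ => sT x)); rewrite size_map size_iota.
Qed.

End PowerFunctions.

(** * Reduced polynomials and coordinates *)

Section ReducedExponents.
Variables (F : fieldType) (d : nat).
Implicit Types (m : 'X_{1..d}) (t : 'I_d -> F).
Local Notation cardF q := ([set: F]%classic #= `I_q)%card.

Definition reduced_exponent m := forall q, cardF q -> forall i, (m i < q)%N.

(** Linear independence of the functions [t |-> t^m] for reduced [m].  The
    coefficient at [m0] is isolated one variable at a time: once the terms are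
    restricted to those agreeing with [m0] in the first k variables, the sum is
    a polynomial in the next variable, of size at most [|F|], that vanishes
    everywhere. *)
Lemma reduced_indep (S : seq 'X_{1..d}) (c : 'X_{1..d} -> F) :
  uniq S -> {in S, forall m, reduced_exponent m} ->
  (forall t, \sum_(m <- S) c m * \prod_i t i ^+ m i = 0) ->
  {in S, forall m, c m = 0}.
Proof.
move=> uS redS vanish m0 m0S.
pose agree k m := [forall i : 'I_d, (i < k)%N ==> (m i == m0 i)].
have extract k : (k <= d)%N -> forall t,
  \sum_(m <- S | agree k m) c m * \prod_(i < d | (k <= i)%N) t i ^+ m i = 0.
  elim: k => [_ t|k IH kd t].
    by rewrite -[RHS](vanish t); apply: eq_bigl => m; apply/forallP.
  pose i0 := Ordinal kd.
  pose coeff m := c m * \prod_(i < d | (k < i)%N) t i ^+ m i.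
  (* The sum as a polynomial in the variable of index k, the later ones fixed. *)
  pose p : {poly F} := \sum_(m <- S | agree k m) coeff m *: 'X^(m i0).
  have p0 : p = 0.
    apply: poly_vanish_eq0 => [q Fq|a].
      rewrite /p big_seq_cond; elim/big_ind: _ => [|x y xq yq|m].
      - by rewrite size_poly0.
      - by rewrite (leq_trans (size_polyD _ _)) // geq_max xq.
      - move=> /andP[/redS mr _]; rewrite (leq_trans (size_scale_leq _ _)) //.
        by rewrite size_polyXn mr.
    pose t' i := if i == i0 then a else t i.
    rewrite -[RHS](IH (ltnW kd) t') /p horner_sum; apply: eq_bigr => m _.
    rewrite hornerZ hornerXn /coeff -mulrA; congr (_ * _).
    rewrite [RHS](bigD1 i0) //= {1}/t' eqxx mulrC; congr (_ * _).
    apply: eq_big => [i|i ki].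
      by rewrite ltn_neqAle andbC eq_sym.
    by rewrite /t' ifN //; apply/eqP => ii0; move: ki; rewrite ii0 ltnn.
  have /(congr1 (fun p : {poly F} => p`_(m0 i0))) := p0.
  rewrite coef0 /p coef_sum => E; rewrite -[RHS]E [LHS]big_mkcond [RHS]big_mkcond.
  apply: eq_bigr => m _; rewrite coefZ coefXn.
  have -> : agree k.+1 m = agree k m && (m0 i0 == m i0).
    apply/forallP/andP => [ag|[/forallP ag /eqP m0i] i].
      split; last by rewrite eq_sym; apply: (implyP (ag i0)).
      apply/forallP => i; apply/implyP => ik.
      by apply: (implyP (ag i)); apply: ltnW.
    apply/implyP; rewrite ltnS leq_eqVlt => /orP[/eqP ik|ik].
      by rewrite (_ : i = i0) ?m0i; last exact: val_inj.
    exact: (implyP (ag i)).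
  by case: (agree k m) => //=; case: eqP; rewrite ?mulr1 ?mulr0.
have := extract d (leqnn d) (fun=> 0).
rewrite big_mkcond (bigD1_seq m0) //= [X in _ + X]big1 ?addr0 => [|m /eqP mm0].
  rewrite ifT; last by apply/forallP => i; rewrite eqxx implybT.
  by rewrite big1 ?mulr1 // => i; rewrite leqNgt ltn_ord.
rewrite ifF //; apply/negP => /forallP ag; case: mm0; apply/mnmP => i.
by apply/eqP; apply: (implyP (ag i)); rewrite ltn_ord.
Qed.

(** Over a field with q elements, [x^q = x] lets a positive exponent be replaced
    by the exponent between 1 and [q.-1] congruent to it modulo [q.-1]. *)
Lemma reduce_mpoly (f : {mpoly F[d]}) : exists2 g : {mpoly F[d]},
  {in msupp g, forall m, reduced_exponent m} & forall t, g.@[t] = f.@[t].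
Proof.
have [[q Fq]|Finf] := pselect (finite_set [set: F]%classic); last first.
  by exists f => // m _ q Fq; case: Finf; exists q.
have q1 := field_card_gt1 Fq.
have q0 : (0 < q.-1)%N by case: q q1 {Fq} => [|[]].
(* Positive exponents stay positive: x^0 and x^q.-1 differ at 0. *)
pose r k := if k is k'.+1 then (k' %% q.-1).+1 else 0%N.
have rq k : (r k < q)%N.
  case: k => [|k] /=; first exact: leq_trans q1.
  by have := ltn_pmod k q0; case: q q1 {Fq q0 r}.
have rX k (a : F) : a ^+ r k = a ^+ k.
  case: k => // k /=; have [->|a0] := eqVneq a 0; first by rewrite !expr0n.
  by rewrite !exprS exp_modn_field.
exists (\sum_(m <- msupp f) f@_m *: 'X_[[multinom r (m i) | i < d]]).
  move=> m /msupp_sum_le /flattenP[s /mapP[m' _ ->]] /msuppZ_le.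
  rewrite msuppX inE => /eqP -> q' Fq' i; rewrite mnmE.
  by have -> // : q' = q; apply/card_eq_II; rewrite (card_eq_trans _ Fq) // card_eq_sym.
move=> t; rewrite [RHS]mevalE raddf_sum; apply: eq_bigr => m _ /=.
rewrite mevalZ mevalX; congr (_ * _).
by apply: eq_bigr => i _; rewrite mnmE rX.
Qed.

End ReducedExponents.

Section Coordinates.
Variables (F : fieldType) (V : vectType F).
Local Notation d := (\dim (fullv : {vspace V})).
Variables (e : d.-tuple V) (eb : basis_of fullv e).
Implicit Types (m : 'X_{1..d}) (t : 'I_d -> F) (v : V) (alpha : V -> F).

Definition monomial m v : F := \prod_i coord e i v ^+ m i.

Definition diag t v : V := \sum_i (t i * coord e i v) *: e`_i.

Lemma coord_sum_basis (a : 'I_d -> F) i : coord e i (\sum_j a j *: e`_j) = a i.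
Proof. by rewrite coord_sum_free // (basis_free eb). Qed.

Lemma coord_diag t v i : coord e i (diag t v) = t i * coord e i v.
Proof. exact: coord_sum_basis. Qed.

Lemma diag_is_linear t a u v : diag t (a *: u + v) = a *: diag t u + diag t v.
Proof.
rewrite /diag scaler_sumr -big_split /=; apply: eq_bigr => i _.
by rewrite linearP /= scalerA -scalerDl mulrDr mulrCA.
Qed.

HB.instance Definition _ t :=
  GRing.isLinear.Build F V V _ (diag t) (diag_is_linear t).

Lemma monomial_diag m t v :
  monomial m (diag t v) = \prod_i t i ^+ m i * monomial m v.
Proof.
rewrite /monomial -big_split; apply: eq_bigr => i _.
by rewrite coord_diag exprMn.
Qed.

Lemma monomialZ m a v : monomial m (a *: v) = a ^+ mdeg m * monomial m v.
Proof.
rewrite /monomial mdegE -prodrXr -big_split; apply: eq_bigr => i _.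
by rewrite linearZ exprMn.
Qed.

Lemma monomial0 m : mdeg m != 0%N -> monomial m 0 = 0.
Proof.
by move=> m0; rewrite -(scale0r 0) monomialZ expr0n (negbTE m0) mul0r.
Qed.

Lemma realizesP (f : {mpoly F[d]}) alpha : realizes e f alpha <->
  alpha = fun v => \sum_(m <- msupp f) f@_m * monomial m v.
Proof.
split=> [fa|-> a].
  apply/funext => v; rewrite [in LHS](coord_basis eb (memvf v)) fa mevalE.
  by [].
rewrite mevalE; apply: eq_bigr => m _; congr (_ * _).
by apply: eq_bigr => i _; rewrite coord_sum_basis.
Qed.

End Coordinates.

(** * The defect of a general map *)

Section SubsetSums.
Variables (R : comNzRingType) (T : finType).
Implicit Types (A B I : {set T}).

(** If [x] is not in [A], adding and removing [x] pairs the sets containing [A]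
    into pairs of opposite signs. *)
Lemma sum_sign_supsets A :
  \sum_(I : {set T} | A \subset I) (-1) ^+ (#|T| - #|I|) = (A == setT)%:R :> R.
Proof.
have [->|AT] := eqVneq A setT.
  rewrite (big_pred1 setT); first by rewrite cardsT subnn expr0.
  by move=> I; rewrite subTset.
have /subsetPn[x _ xA] : ~~ (setT \subset A) by rewrite subTset.
rewrite (bigID (fun I : {set T} => x \in I)) /=.
rewrite (reindex_onto (fun I => x |: I)%SET (fun I => I :\ x)%SET) /=; last first.
  by move=> I /andP[_ xI]; rewrite setD1K.
rewrite [X in X + _](eq_bigl (fun I => (A \subset I) && (x \notin I))) => [|I].
  rewrite -big_split big1 //= => I /andP[_ xI].
  rewrite cardsU1 xI add1n -[(#|T| - #|I|)%N]prednK ?subnS ?exprS ?mulN1r ?subrr //.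
  rewrite subn_gt0 -cardsT; apply: proper_card; rewrite properEneq subsetT.
  by rewrite andbT; apply/eqP => IT; rewrite IT inE in xI.
rewrite setU11 andbT; case: (boolP (x \in I)) => xI /=.
  rewrite andbF; apply/negP => /andP[_ /eqP/setP/(_ x)].
  by rewrite !inE eqxx xI.
rewrite setU1K // eqxx !andbT.
apply/idP/idP => [AI|AI]; last exact: (fintype.subset_trans AI (subsetU1 _ _)).
apply/subsetP => y yA; have := subsetP AI y yA; rewrite in_setU1.
by case: eqP => // yx; rewrite -yx yA in xA.
Qed.

(** The subsets of [A] of size k are counted by a binomial coefficient divisible
    by p, unless k is 0 or p. *)
Lemma sum_subsets_pchar p A (h : nat -> R) : p \in [pchar R] -> #|A| = p ->
  \sum_(I : {set T} | I \subset A) h #|I| = h 0%N + h p.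
Proof.
move=> pR Ap; have p0 := prime_gt0 (pcharf_prime pR).
rewrite (partition_big (fun I => inord #|I| : 'I_p.+1) xpredT) //=.
under eq_bigr => k _.
  rewrite (eq_bigr (fun=> h k)) => [|I /andP[IA /eqP <-]]; last first.
    by rewrite inordK // ltnS -Ap subset_leq_card.
  rewrite (eq_bigl (mem [set I : {set T} | I \subset A & #|I| == k]%SET)); last first.
    move=> I; rewrite !inE -val_eqE /=; case: (boolP (I \subset A)) => //= IA.
    by rewrite inordK // ltnS -Ap subset_leq_card.
  rewrite sumr_const cards_draws Ap -mulr_natr.
  over.
(* Only the terms k = 0 and k = p of the sum over 'I_p.+1 remain. *)
case: p pR {Ap p0} => // p pR; rewrite big_ord_recl big_ord_recr /= big1 => [|k _].
  by rewrite add0r bin0 binn !mulr1.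
by rewrite bin_lt_pcharf_0 ?mulr0 //= ltnS ltn_ord.
Qed.

End SubsetSums.

Section DefectGeneral.
Variables (F : fieldType) (V : vectType F) (n : nat).
Implicit Types (alpha : V -> F) (u : {ffun 'I_n -> V}).

Lemma defect_all alpha u : alpha 0 = 0 ->
  defect alpha u =
    \sum_(I : {set 'I_n}) (-1) ^+ (n - #|I|) * alpha (\sum_(i in I) u i).
Proof.
move=> a0; rewrite /defect [RHS](bigD1 set0) //= big_set0 a0.
by rewrite mulr0 add0r.
Qed.

Lemma defect_symmetric alpha : Defs.symmetric_form (@defect F V n alpha).
Proof.
move=> s u; rewrite /defect.
rewrite [RHS](reindex_inj (imset_inj (@perm_inj _ s))) /=.
apply: eq_big => I; first by rewrite imset_eq0.
move=> _; rewrite card_imset; last exact: perm_inj.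
congr (_ * alpha _); rewrite big_imset /=; last by move=> i j _ _; apply: perm_inj.
by apply: eq_bigr => i _; rewrite ffunE.
Qed.

Lemma defect_sum (I : Type) (S : seq I) (c : I -> F) (beta : I -> V -> F) u :
  defect (fun v => \sum_(m <- S) c m * beta m v) u
  = \sum_(m <- S) c m * defect (beta m) u.
Proof.
rewrite /defect; under [RHS]eq_bigr do rewrite mulr_sumr.
rewrite exchange_big /=; apply: eq_bigr => J _; rewrite mulr_sumr.
by apply: eq_bigr => m _; rewrite mulrCA.
Qed.

Lemma defect_comp (h : {linear V -> V}) alpha u :
  defect (alpha \o h) u = defect alpha [ffun i => h (u i)].
Proof.
rewrite /defect; apply: eq_bigr => I _; congr (_ * _).
by rewrite /= linear_sum; congr alpha; apply: eq_bigr => i _; rewrite ffunE.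
Qed.

(** Fix the part B of the index set lying outside of the p repeated positions.
    The remaining sum over subsets of these positions reduces to its two
    extreme terms.  They involve the same value of [alpha], since [v *+ p = 0],
    with the opposite signs [(-1)^p] and [1]. *)
Lemma defect_pchar_vanish p alpha v (w : 'I_n -> V) :
  p \in [pchar F] -> (p <= n)%N -> alpha 0 = 0 ->
  defect alpha [ffun i : 'I_n => if (i < p)%N then v else w i] = 0.
Proof.
move=> pF pn a0; rewrite defect_all //.
pose P := [set i : 'I_n | (i < p)%N]%SET.
have cP : #|P| = p.
  have wi : injective (widen_ord pn) by move=> i j E; apply/val_inj/(congr1 val E).
  rewrite -[RHS]card_ord -(card_imset _ wi).
  apply: eq_card => i; rewrite inE; apply/idP/imsetP => [ip|[j _ ->]].
    by exists (Ordinal ip) => //; apply/val_inj.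
  exact: (ltn_ord j).
rewrite (partition_big (fun I => I :\: P)%SET (fun B => B \subset ~: P)%SET) /=;
  last by move=> I _; rewrite setDE subsetIr.
apply: big1 => B BP.
have dBP : [disjoint B & P] by rewrite disjoints_subset.
(* A set I with I :\: P = B is A :|: B for a unique subset A of P. *)
rewrite (reindex_onto (fun A => A :|: B)%SET (fun I => I :&: P)%SET) /=;
  last by move=> I /eqP <-; rewrite setID.
rewrite (eq_bigl (fun A : {set 'I_n} => A \subset P)); last first.
  move=> A; rewrite setDUl setIUl (disjoint_setI0 dBP).
  rewrite setU0 (setDidPl dBP); apply/andP/idP => [[_ /eqP <-]|AP].
    exact: subsetIr.
  by rewrite (setIidPl AP) (eqP (_ : A :\: P == set0)%SET)
     ?set0U ?setD_eq0.
pose h k := (-1) ^+ (n - (k + #|B|)) * alpha (v *+ k + \sum_(i in B) w i).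
transitivity (\sum_(A : {set 'I_n} | A \subset P) h #|A|).
  apply: eq_bigr => A AP.
  have dAB : [disjoint A & B].
    by rewrite disjoint_sym; apply: disjointWr dBP.
  rewrite cardsU (disjoint_setI0 dAB) cards0 subn0 /h; congr (_ * alpha _).
  rewrite (eq_bigl (fun i => i \in [predU A & B])) => [|i]; last by rewrite !inE.
  rewrite bigU //=; congr (_ + _).
    rewrite -sumr_const; apply: eq_bigr => i iA; rewrite ffunE.
    by have := subsetP AP i iA; rewrite inE => ->.
  apply: eq_bigr => i iB; rewrite ffunE.
  by have := subsetP BP i iB; rewrite !inE => /negbTE ->.
rewrite (sum_subsets_pchar _ pF cP) /h add0n mulr0n.
have -> : v *+ p = 0 by rewrite -scaler_nat (pcharf0 pF) scale0r.
have pB : (p <= n - #|B|)%N.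
  have := subset_leq_card BP; rewrite (cardsCs (~: P)) setCK card_ord cP => Bnp.
  by rewrite leq_subRL ?(leq_trans Bnp) ?leq_subr // addnC -leq_subRL.
rewrite -mulrDl addnC subnDA -[X in (-1) ^+ X](subnK pB) exprD.
by rewrite (@exprNn_pchar _ 1 p) ?pnatE ?(pcharf_prime pF) // expr1n mulrN1 addNr mul0r.
Qed.

End DefectGeneral.

(** * Defects of products of coordinates *)

Section IndexType.
Variable d : nat.

(** The exponent of the monomial obtained by multiplying the variables
    of index [j 0], ..., [j n.-1]. *)
Definition index_type n (j : {ffun 'I_n -> 'I_d}) : 'X_{1..d} :=
  [multinom #|[set k | j k == i]%SET| | i < d].

Lemma prod_index_type (R : comNzRingType) n (j : {ffun 'I_n -> 'I_d}) (x : 'I_d -> R) :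
  \prod_k x (j k) = \prod_i x i ^+ index_type j i.
Proof.
rewrite (partition_big j xpredT) //=; apply: eq_bigr => i _.
rewrite mnmE (eq_bigr (fun=> x i)) => [|k /eqP -> //].
rewrite -prodr_const; apply: eq_bigl => k; by rewrite inE.
Qed.

Lemma mdeg_index_type n (j : {ffun 'I_n -> 'I_d}) : mdeg (index_type j) = n.
Proof.
rewrite mdegE -[RHS]card_ord -sum1_card (partition_big j xpredT) //=.
by apply: eq_bigr => i _; rewrite mnmE -sum1_card; apply: eq_bigl => k; rewrite inE.
Qed.

Lemma count_index_type n (j : {ffun 'I_n -> 'I_d}) i :
  count_mem i (codom j) = index_type j i.
Proof.
rewrite mnmE codomE count_map cardsE cardE size_filter -enumT.
by apply: eq_count => k.
Qed.

Lemma index_type_exists (m : 'X_{1..d}) :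
  exists j : {ffun 'I_(mdeg m) -> 'I_d}, index_type j = m.
Proof.
pose s := flatten [seq nseq (m i) i | i : 'I_d].
have ss : size s = mdeg m.
  rewrite size_flatten /shape -map_comp sumnE big_map mdegE big_enum /=.
  by apply: eq_bigr => i _; rewrite size_nseq.
pose t : (mdeg m).-tuple 'I_d := tcast ss (in_tuple s).
exists [ffun k => tnth t k]; apply/mnmP => i; rewrite -count_index_type.
have -> : codom [ffun k => tnth t k] = s.
  rewrite codomE (eq_map (fun k => ffunE (tnth t) k)) map_tnth_enum.
  exact: val_tcast.
rewrite count_flatten -map_comp sumnE big_map big_enum /= (bigD1 i) //= big1 => [|k ki].
  by rewrite count_nseq /= eqxx mul1n addn0.
by rewrite count_nseq /= (negbTE ki).
Qed.

Lemma index_type_eqP n (j r : {ffun 'I_n -> 'I_d}) :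
  index_type j = index_type r <-> exists s : 'S_n, forall k, r (s k) = j k.
Proof.
split=> [jr|[s rs]]; last first.
  apply/mnmP => i; rewrite !mnmE -(card_imset _ (@perm_inj _ s)).
  apply: eq_card => k; rewrite inE -[k in RHS](permKV s) rs.
  by rewrite -[k in LHS](permKV s) mem_imset ?inE //; apply: perm_inj.
have: perm_eq [tuple j k | k < n] [tuple r k | k < n].
  rewrite /= -!codomE; apply/allP => i _ /=.
  by rewrite !count_index_type jr.
move=> /tuple_permP[s js]; exists s => k.
have /(congr1 (fun t : n.-tuple _ => tnth t k)) : [tuple j k | k < n] =
    [tuple tnth [tuple r k | k < n] (s i) | i < n] by apply/val_inj.
by rewrite !tnth_mktuple.
Qed.

Definition index_stab n (j : {ffun 'I_n -> 'I_d}) : {set 'S_n} :=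
  [set s : 'S_n | [forall k, j (s k) == j k]]%SET.

End IndexType.


Section ProductDefect.
Variables (F : fieldType) (V : vectType F).
Local Notation d := (\dim (fullv : {vspace V})).
Variables (e : d.-tuple V) (eb : basis_of fullv e).

(** A monomial as a sequence of linear factors, the form in which it can be
    polarized. *)
Definition coord_prod N (j : {ffun 'I_N -> 'I_d}) (v : V) : F :=
  \prod_k coord e (j k) v.

(** Expanding each factor at a sum of arguments gives a sum over the functions
    [g] from factors to arguments; the signed sum over the sets [I] containing
    the image of [g] vanishes unless [g] is surjective. *)
Lemma defect_coord_prod n N (j : {ffun 'I_N -> 'I_d}) (u : {ffun 'I_n -> V}) :
  (0 < N)%N ->
  defect (coord_prod j) u =
    \sum_(g : {ffun 'I_N -> 'I_n} | (g @: setT == setT)%SET)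
      \prod_k coord e (j k) (u (g k)).
Proof.
move=> N0; rewrite defect_all; last first.
  by rewrite /coord_prod (bigD1 (Ordinal N0)) //= linear0 mul0r.
transitivity (\sum_(I : {set 'I_n}) \sum_(g : {ffun 'I_N -> 'I_n} | g @: setT \subset I)
   (-1) ^+ (n - #|I|) * \prod_k coord e (j k) (u (g k))).
  apply: eq_bigr => I _; rewrite -mulr_sumr; congr (_ * _).
  rewrite /coord_prod; under eq_bigr do rewrite linear_sum.
  rewrite bigA_distr_big; apply: eq_bigl => g.
  apply/ffun_onP/subsetP => [gI _ /imsetP[k _ ->] //|gI k].
  by apply/gI/imset_f.
rewrite (exchange_big_dep xpredT) //= [RHS]big_mkcond; apply: eq_bigr => g _.
have := sum_sign_supsets F (g @: setT)%SET; rewrite card_ord -mulr_suml => ->.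
by case: eqP; rewrite ?mul1r ?mul0r.
Qed.

Lemma defect_coord_prod_gt n N (j : {ffun 'I_N -> 'I_d}) (u : {ffun 'I_n -> V}) :
  (0 < N)%N -> (N < n)%N -> defect (coord_prod j) u = 0.
Proof.
move=> N0 Nn; rewrite defect_coord_prod // big_pred0 // => g.
apply/negbTE/eqP => gT; move: Nn; rewrite ltnNge -[n]card_ord -cardsT -gT.
by rewrite -[X in (_ <= X)%N]card_ord -cardsT leq_imset_card.
Qed.

Lemma defect_coord_prod_perm n (j : {ffun 'I_n -> 'I_d}) (u : {ffun 'I_n -> V}) :
  (0 < n)%N ->
  defect (coord_prod j) u = \sum_(s : 'S_n) \prod_k coord e (j k) (u (s k)).
Proof.
move=> n0; rewrite defect_coord_prod //.
have inj (g : {ffun 'I_n -> 'I_n}) : (g @: setT == setT)%SET = injectiveb g.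
  apply/eqP/injectiveP => [gT|gI].
    have /imset_injP gI : #|(g @: setT)%SET| == #|[set: 'I_n]%SET| by rewrite gT.
    by move=> x y; apply: gI; rewrite inE.
  apply/eqP; rewrite eqEcard subsetT card_imset //= leqnn.
rewrite (reindex_onto (@pval _) (fun g : {ffun _} => insubd (1%g : 'S_n) g)) /=; last first.
  by move=> g; rewrite inj => gI; apply: (insubdK (1%g : 'S_n)).
apply: eq_big => [s|s _].
  rewrite inj (valP s) /=.
  by rewrite valKd eqxx.
by apply: eq_bigr => k _; rewrite pvalE.
Qed.

(** Each term of the sum over permutations contains the ith argument in exactly
    one factor. *)
Lemma coord_prod_multilinear n (j : {ffun 'I_n -> 'I_d}) : (0 < n)%N ->
  multilinear_form (@defect F V n (coord_prod j)).
Proof.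
move=> n0 i u a x y upd; rewrite !defect_coord_prod_perm // mulr_sumr -big_split.
apply: eq_bigr => s _ /=; pose k := (s^-1)%g i.
have split z : \prod_k coord e (j k) (upd z (s k)) =
    coord e (j k) z * \prod_(l | l != k) coord e (j l) (u (s l)).
  rewrite (bigD1 k) //= {1}/upd ffunE permKV eqxx; congr (_ * _).
  apply: eq_bigr => l lk; rewrite ffunE ifN //; apply: contraNneq lk => sl.
  by rewrite /k -sl permK.
by rewrite !split linearP /= mulrDl mulrA.
Qed.

Lemma coord_basis_vec (i k : 'I_d) : coord e i e`_k = (k == i)%:R.
Proof.
by rewrite coord_free ?(basis_free eb).
Qed.

Lemma defect_coord_prod_basis n (j : {ffun 'I_n -> 'I_d}) : (0 < n)%N ->
  defect (coord_prod j) [ffun k => e`_(j k)] = #|index_stab j|%:R.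
Proof.
move=> n0; rewrite defect_coord_prod_perm // -sum1_card natr_sum [RHS]big_mkcond /=.
apply: eq_bigr => s _; rewrite inE.
case: (boolP [forall k, _]) => [/forallP js|/forallPn[k jk]].
  by rewrite big1 // => k _; rewrite ffunE coord_basis_vec js.
by rewrite (bigD1 k) //= ffunE coord_basis_vec (negbTE jk) mul0r.
Qed.

Lemma defect_coord_prod_basis0 n (j r : {ffun 'I_n -> 'I_d}) : (0 < n)%N ->
  (forall s : 'S_n, exists k, r (s k) != j k) ->
  defect (coord_prod j) [ffun k => e`_(r k)] = 0.
Proof.
move=> n0 jr; rewrite defect_coord_prod_perm //; apply: big1 => s _.
have [k rk] := jr s.
by rewrite (bigD1 k) //= ffunE coord_basis_vec (negbTE rk) mul0r.
Qed.

End ProductDefect.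

(** * Stabilizers and multilinear forms *)

Section IndexStab.
Variables (F : fieldType) (d n : nat).
Implicit Types (j r : {ffun 'I_n -> 'I_d}).

Lemma index_stab_group_set j : group_set (index_stab j).
Proof.
apply/group_setP; split=> [|s t]; first by rewrite inE; apply/forallP => k; rewrite perm1.
rewrite !inE => /forallP js /forallP jt; apply/forallP => k.
by rewrite permM (eqP (jt _)).
Qed.

(** If p divides the order of the stabilizer, Cauchy's theorem yields a
    permutation of order p fixing [j].  A nontrivial orbit of this permutation
    has p elements, and [j] is constant on it. *)
Lemma index_stab_natr_eq0 j : #|index_stab j|%:R = 0 :> F ->
  exists p i, p \in [pchar F] /\ (p <= index_type j i)%N.
Proof.
pose G := group (index_stab_group_set j); move=> G0.
have [p pF] : exists p, p \in [pchar F].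
  apply/not_existsP => np.
  have /pcharf0P/(_ #|G|) : [pchar F] =i pred0.
    by move=> p; apply/negbTE/negP => /np.
  by rewrite G0 eqxx eqn0Ngt cardG_gt0.
have pp := pcharf_prime pF.
have pG : (p %| #|G|)%N by rewrite (dvdn_pcharf pF) G0.
have [s sG os] := Cauchy pp pG.
have [x sx] : exists x, s x != x.
  apply/existsP; apply: contraPT (prime_gt1 pp) => /existsPn sid.
  rewrite -os (_ : s = 1%g) ?order1 //; apply/permP => x.
  by rewrite perm1; apply/eqP; rewrite -[_ == _]negbK.
exists p, (j x); split=> //; rewrite mnmE.
have jG t y : t \in G -> j (t y) = j y.
  by rewrite inE => /forallP/(_ y)/eqP.
have cO : #|orbit 'P <[s]>%g x| = p.
  have := dvdn_orbit 'P <[s]>%G x; rewrite -orderE os => /(primeP pp).2.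
  case/orP => /eqP // O1; case/eqP: sx.
  have /cards1P[y Oy] : #|orbit 'P <[s]>%g x| == 1%N by rewrite O1.
  have := orbit_refl 'P <[s]>%g x; rewrite Oy inE => /eqP xy.
  have : s x \in orbit 'P <[s]>%g x by apply/orbitP; exists s; rewrite ?cycle_id.
  by rewrite Oy inE => /eqP; rewrite -xy.
rewrite -cO subset_leq_card //; apply/subsetP => y /orbitP[t ts <-].
rewrite inE /= jG //; have : <[s]>%g \subset G by rewrite cycle_subG.
by move/subsetP; apply.
Qed.

End IndexStab.

Section Multilinear.
Variables (F : fieldType) (V : vectType F).
Local Notation d := (\dim (fullv : {vspace V})).
Variables (e : d.-tuple V) (eb : basis_of fullv e) (n : nat).
Implicit Types (phi psi : {ffun 'I_n -> V} -> F) (u : {ffun 'I_n -> V}).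

(** The arguments are made arbitrary one position at a time, expanding the
    vector in that position along the basis. *)
Lemma multilinear_basis_eq0 phi : multilinear_form phi ->
  (forall r : {ffun 'I_n -> 'I_d}, phi [ffun k => e`_(r k)] = 0) ->
  forall u, phi u = 0.
Proof.
move=> phil phi0.
have partial l : (l <= n)%N -> forall u,
    (forall k : 'I_n, (l <= k)%N -> exists i : 'I_d, u k = e`_i) -> phi u = 0.
  elim: l => [_ u ub|l IH ln u ub].
    have /choice[r rE] : forall k, exists i : 'I_d, u k = e`_i by move=> k; apply: ub.
    rewrite -(phi0 [ffun k => r k]); congr phi; apply/ffunP => k.
    by rewrite !ffunE rE.
  pose i0 := Ordinal ln.
  pose upd z := [ffun k => if k == i0 then z else u k] : {ffun 'I_n -> V}.
  have updl a x y : phi (upd (a *: x + y)) = a * phi (upd x) + phi (upd y).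
    exact: phil.
  have upd0 : phi (upd 0) = 0.
    by have := updl (-1) 0 0; rewrite scaler0 addr0 mulN1r addNr.
  have -> : u = upd (u i0) by apply/ffunP => k; rewrite ffunE; case: eqP => [->|].
  rewrite (coord_basis eb (memvf (u i0))).
  elim/big_rec: _ => // i z _ z0; rewrite updl z0 addr0 (IH (ltnW ln)) ?mulr0 //.
  move=> k lk; rewrite ffunE; case: eqP => [_|ki]; first by exists i.
  apply: ub; rewrite ltn_neqAle lk andbT; apply/eqP => lk'; apply: ki.
  exact/val_inj.
by move=> u; apply: (partial n) => // k; rewrite leqNgt ltn_ord.
Qed.

(** Characteristic forms are constrained by putting the repeated vector in the
    first p positions; a permutation brings any p equal arguments there. *)
Lemma symmetric_repeat_eq0 phi p u x :
  Defs.symmetric_form phi ->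
  (forall (v : V) (w : 'I_n -> V),
    phi [ffun i : 'I_n => if (i < p)%N then v else w i] = 0) ->
  (p <= #|[set k | u k == x]%SET|)%N -> phi u = 0.
Proof.
move=> phis phi0 pu.
(* The arguments reordered so that the copies of x come first. *)
pose s := [seq v <- [tuple u k | k < n] | v == x] ++
          [seq v <- [tuple u k | k < n] | v != x].
have : perm_eq s [tuple u k | k < n] by rewrite perm_filterC.
move=> /tuple_permP[t st]; rewrite -(phis t).
rewrite -[RHS](phi0 x (fun k => u (t k))); congr phi; apply/ffunP => k.
rewrite !ffunE; case: ifP => // kp.
have : nth x s k = u (t k).
  by rewrite st -(tnth_nth x [tuple _ | _ < n] k) !tnth_mktuple.
have sp : (p <= size [seq v <- [tuple u k | k < n] | v == x])%N.
  rewrite (leq_trans pu) // size_filter count_map cardsE cardE size_filter -enumT.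
  by [].
rewrite /s nth_cat (leq_trans kp sp) => <-.
have /(mem_nth x) := leq_trans kp sp.
by rewrite mem_filter => /andP[/eqP].
Qed.

End Multilinear.

(** * Monomials and their defects *)

Section Monomials.
Variables (F : fieldType) (V : vectType F).
Local Notation d := (\dim (fullv : {vspace V})).
Variables (e : d.-tuple V) (eb : basis_of fullv e).
Implicit Types (m : 'X_{1..d}).

Lemma coord_prodE n (j : {ffun 'I_n -> 'I_d}) :
  coord_prod e j = monomial e (index_type j).
Proof. by apply/funext => v; exact: (prod_index_type j (fun i => coord e i v)). Qed.

Lemma defect_monomial_gt n m (u : {ffun 'I_n -> V}) :
  mdeg m != 0%N -> (mdeg m < n)%N -> defect (monomial e m) u = 0.
Proof.
have [j <-] := index_type_exists m; rewrite mdeg_index_type -coord_prodE => m0 mn.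
by apply: defect_coord_prod_gt => //; rewrite lt0n.
Qed.

Lemma monomial_multilinear m : mdeg m != 0%N ->
  multilinear_form (@defect F V (mdeg m) (monomial e m)).
Proof.
have [j jm] := index_type_exists m; rewrite -lt0n => m0.
have -> : monomial e m = coord_prod e j by rewrite coord_prodE jm.
exact: coord_prod_multilinear.
Qed.

Lemma totally_reduced_defect_neq0 m : mdeg m != 0%N -> totally_reduced m ->
  exists u : {ffun 'I_(mdeg m) -> V}, defect (monomial e m) u <> 0.
Proof.
have [j jm] := index_type_exists m; rewrite -lt0n => m0 mr.
have -> : monomial e m = coord_prod e j by rewrite coord_prodE jm.
exists [ffun k => e`_(j k)]; rewrite defect_coord_prod_basis //.
move=> /index_stab_natr_eq0[p [i [pF]]].
by rewrite jm leqNgt mr.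
Qed.

Lemma defect_eq0_leq n k (alpha : V -> F) : alpha 0 = 0 -> (0 < n <= k)%N ->
  (forall u : {ffun 'I_n -> V}, defect alpha u = 0) ->
  forall u : {ffun 'I_k -> V}, defect alpha u = 0.
Proof.
move=> a0 /andP[n0 nk] dn; rewrite -(subnK nk); elim: (k - n)%N => // l IHl.
by case: n n0 IHl {dn nk} => // n _; rewrite !addnS addSn; apply: defect_eq0S.
Qed.

(** In degree less than n the nth defect would vanish; in degree greater than n
    the top defect, which is nonzero, would vanish together with the defect of
    order n + 1. *)
Lemma totally_reduced_mdeg n m : mdeg m != 0%N -> totally_reduced m ->
  (exists u : {ffun 'I_n -> V}, defect (monomial e m) u <> 0) ->
  (forall u : {ffun 'I_n.+1 -> V}, defect (monomial e m) u = 0) -> mdeg m = n.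
Proof.
move=> m0 mr [u un0] dn1; have mz := monomial0 e m0.
case: (ltngtP (mdeg m) n) => // [mn|nm]; first by rewrite defect_monomial_gt in un0.
have [v []] := totally_reduced_defect_neq0 m0 mr.
exact: (defect_eq0_leq mz _ dn1).
Qed.

Lemma multilinear_scale n (phi : {ffun 'I_n -> V} -> F) (c : 'I_n -> F)
    (u : {ffun 'I_n -> V}) :
  multilinear_form phi -> phi [ffun k => c k *: u k] = \prod_k c k * phi u.
Proof.
move=> phil.
have partial l : (l <= n)%N ->
    phi [ffun k : 'I_n => if (k < l)%N then c k *: u k else u k] =
    \prod_(k < n | (k < l)%N) c k * phi u.
  elim: l => [_|l IH ln].
    by rewrite big_pred0 // mul1r; congr phi; apply/ffunP => k; rewrite ffunE.
  pose i0 := Ordinal ln.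
  pose w := [ffun k : 'I_n => if (k < l)%N then c k *: u k else u k] : {ffun 'I_n -> V}.
  pose upd z := [ffun k => if k == i0 then z else w k] : {ffun 'I_n -> V}.
  have updl a x y : phi (upd (a *: x + y)) = a * phi (upd x) + phi (upd y).
    exact: phil.
  have upd0 : phi (upd 0) = 0.
    by have := updl (-1) 0 0; rewrite scaler0 addr0 mulN1r addNr.
  rewrite (_ : [ffun _ => _] = upd (c i0 *: u i0 + 0)); last first.
    apply/ffunP => k; rewrite !ffunE addr0 ltnS leq_eqVlt -val_eqE /=.
    by case: eqP => // kl; have -> : k = i0 by apply/val_inj.
  rewrite updl upd0 addr0 (_ : upd _ = w); last first.
    apply/ffunP => k; rewrite !ffunE.
    by case: eqP => // ->; rewrite ltnn.
  rewrite IH ?(ltnW ln) // mulrA; congr (_ * _).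
  rewrite [RHS](bigD1 i0) //=; congr (_ * _); apply: eq_bigl => k.
  by rewrite ltnS [RHS]andbC -ltn_neqAle.
have := partial n (leqnn n).
rewrite (_ : [ffun _ => _] = [ffun k => c k *: u k]) => [->|].
  by congr (_ * _); apply: eq_bigl => k; rewrite ltn_ord.
by apply/ffunP => k; rewrite !ffunE ltn_ord.
Qed.

Lemma diag_basis_vec (t : 'I_d -> F) (i : 'I_d) : diag e t e`_i = t i *: e`_i.
Proof.
rewrite /diag (bigD1 i) //= coord_basis_vec // eqxx mulr1 big1 ?addr0 // => k ki.
by rewrite coord_basis_vec // eq_sym (negbTE ki) mulr0 scale0r.
Qed.

Lemma defect_monomial_diag n m t (u : {ffun 'I_n -> V}) :
  defect (monomial e m) [ffun k => diag e t (u k)] =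
  \prod_i t i ^+ m i * defect (monomial e m) u.
Proof.
rewrite -(defect_comp (diag e t)) /defect mulr_sumr; apply: eq_bigr => I _.
by rewrite /= monomial_diag // mulrCA.
Qed.

(** A reduced monomial is determined by its weight under diagonal scalings, and
    this weight can be read off a nonzero value of its multilinear defect at
    basis vectors. *)
Lemma multilinear_monomial n m : (0 < n)%N -> mdeg m != 0%N -> reduced_exponent F m ->
  multilinear_form (@defect F V n (monomial e m)) ->
  (exists u : {ffun 'I_n -> V}, defect (monomial e m) u <> 0) ->
  totally_reduced m /\ mdeg m = n.
Proof.
move=> n0 m0 mr Bl [u Bu].
have [r Br] : exists r : {ffun 'I_n -> 'I_d},
    defect (monomial e m) [ffun k => e`_(r k)] <> 0.
  apply/existsNP => B0; apply: Bu.
  exact: (multilinear_basis_eq0 eb Bl).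
have rF p i : p \in [pchar F] -> (index_type r i < p)%N.
  move=> pF; rewrite ltnNge; apply/negP => pi; apply: Br.
  apply: (symmetric_repeat_eq0 (p := p) (x := e`_i) (@defect_symmetric _ _ _ _)).
    move=> v w; apply: defect_pchar_vanish => //; last exact: monomial0.
    apply: (leq_trans pi); rewrite -[n in (_ <= n)%N](mdeg_index_type r) mdegE.
    by rewrite (bigD1 i) //= leq_addr.
  apply: (leq_trans pi); rewrite mnmE; apply/subset_leq_card/subsetP => k.
  by rewrite !inE ffunE => /eqP ->.
suff -> : m = index_type r.
  by split; [move=> p pF i; apply: rF | apply: mdeg_index_type].
apply/mnmP => i; apply: (@exp_eq_reduced F) => [q Fq|a].
  by rewrite mr // (lt_pchar_lt_card (F := F)) // => p; apply: rF.
(* Scaling the ith coordinate alone isolates the exponents at i. *)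
pose t k := if k == i then a else 1.
have tE m' : \prod_k t k ^+ m' k = a ^+ m' i.
  rewrite (bigD1 i) //= {1}/t eqxx big1 ?mulr1 // => k ki.
  by rewrite /t (negbTE ki) expr1n.
apply/eqP; rewrite -!tE -prod_index_type -subr_eq0.
have := defect_monomial_diag m t [ffun k => e`_(r k)].
rewrite (_ : [ffun _ => _] = [ffun k => t (r k) *: [ffun k => e`_(r k)] k]); last first.
  by apply/ffunP => k; rewrite !ffunE diag_basis_vec.
rewrite multilinear_scale // => /esym/eqP; rewrite -subr_eq0 -mulrBl mulf_eq0.
by case/orP => // /eqP.
Qed.

(** A linear functional [T] that vanishes on all diagonal rescalings of a
    polynomial map vanishes on each of its monomials.  It applies to
    functionals that are combinations of values, for which compatibility with
    finite sums is immediate. *)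
Lemma reduced_monomial_transfer (f : {mpoly F[d]}) alpha (T : (V -> F) -> F) :
  (forall (S : seq 'X_{1..d}) (c : 'X_{1..d} -> F) beta,
     T (fun v => \sum_(m <- S) c m * beta m v) = \sum_(m <- S) c m * T (beta m)) ->
  reduced f -> realizes e f alpha -> (forall t, T (alpha \o diag e t) = 0) ->
  {in msupp f, forall m, T (monomial e m) = 0}.
Proof.
move=> Tsum fr /(realizesP eb) fa T0 m mf.
pose c m := f@_m * T (monomial e m).
suff /eqP : c m = 0.
  by rewrite mulf_eq0 => /orP[|/eqP //]; rewrite mcoeff_eq0 mf.
apply: (reduced_indep (S := msupp f)) => // [m' m'f q Fq|t].
  exact: fr.
rewrite -[RHS](T0 t) (_ : alpha \o _ = fun v =>
    \sum_(m <- msupp f) (f@_m * \prod_i t i ^+ m i) * monomial e m v).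
  by rewrite Tsum; apply: eq_bigr => m' _; rewrite mulrAC.
apply/funext => v; rewrite /= fa; apply: eq_bigr => m' _.
by rewrite monomial_diag // mulrA.
Qed.

Lemma monomial_defect_eq0 (f : {mpoly F[d]}) alpha n :
  reduced f -> realizes e f alpha -> (forall u : {ffun 'I_n -> V}, defect alpha u = 0) ->
  {in msupp f, forall m (u : {ffun 'I_n -> V}), defect (monomial e m) u = 0}.
Proof.
move=> fr fa a0 m mf u.
apply: (reduced_monomial_transfer (T := fun a => defect a u) _ fr fa _ mf).
  by move=> *; apply: defect_sum.
by move=> t; rewrite defect_comp a0.
Qed.

Lemma monomial_defect_multilinear (f : {mpoly F[d]}) alpha n :
  reduced f -> realizes e f alpha -> multilinear_form (@defect F V n alpha) ->
  {in msupp f, forall m, multilinear_form (@defect F V n (monomial e m))}.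
Proof.
move=> fr fa al m mf i u a x y upd; apply/eqP; rewrite -subr_eq0; apply/eqP.
apply: (reduced_monomial_transfer (T := fun b : V -> F =>
  defect b (upd (a *: x + y)) - (a * defect b (upd x) + defect b (upd y)))
  _ fr fa _ mf).
  move=> S c beta; rewrite !defect_sum mulr_sumr -big_split -sumrB /=.
  by apply: eq_bigr => k _; rewrite mulrBr mulrDr mulrCA.
move=> t; rewrite !defect_comp.
have updE z : [ffun k => diag e t (upd z k)] =
    [ffun k => if k == i then diag e t z else [ffun k => diag e t (u k)] k].
  by apply/ffunP => k; rewrite !ffunE; case: eqP.
by rewrite !updE linearP al subrr.
Qed.

Lemma monomial_homogeneous (f : {mpoly F[d]}) alpha n :
  reduced f -> realizes e f alpha -> (forall (a : F) v, alpha (a *: v) = a ^+ n * alpha v) ->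
  {in msupp f, forall m (a : F), a ^+ mdeg m = a ^+ n}.
Proof.
move=> fr fa ah m mf a; pose v := \sum_(i < d) 1 *: e`_i.
(* All monomials take the value 1 at [v], leaving the factor a^(mdeg m) - a^n. *)
have mv : monomial e m v = 1.
  by rewrite /monomial big1 // => i _; rewrite coord_sum_basis // expr1n.
have := reduced_monomial_transfer (T := fun b => b (a *: v) - a ^+ n * b v) _ fr fa _ mf.
rewrite monomialZ mv !mulr1 => E; apply/eqP; rewrite -subr_eq0; apply/eqP/E.
  move=> S c beta; rewrite mulr_sumr -sumrB; apply: eq_bigr => k _.
  by rewrite mulrBr mulrCA.
by move=> t; rewrite /= linearZ /= ah subrr.
Qed.

(** Evaluation at the origin is unchanged by diagonal scalings. *)
Lemma monomial_mdeg_neq0 (f : {mpoly F[d]}) alpha :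
  reduced f -> realizes e f alpha -> alpha 0 = 0 ->
  {in msupp f, forall m, mdeg m != 0%N}.
Proof.
move=> fr fa a0 m mf; apply/eqP => /eqP; rewrite mdeg_eq0 => /eqP m0.
have := reduced_monomial_transfer (T := fun b => b 0) _ fr fa _ mf.
rewrite m0 /monomial big1 => [E|i _]; last by rewrite mnm0E.
by have /eqP := E (fun _ _ _ => erefl) (fun t => etrans (congr1 _ (linear0 _)) a0);
  rewrite oner_eq0.
Qed.

End Monomials.

(** * Applications as polynomials *)

Section Applications.
Variables (F : fieldType) (V : vectType F).
Local Notation d := (\dim (fullv : {vspace V})).
Variables (e : d.-tuple V) (eb : basis_of fullv e) (n : nat) (n0 : (0 < n)%N).

Lemma realizes_monomialP (c : F) m beta : realizes e (c *: 'X_[m]) beta <->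
  beta = fun v => c * monomial e m v.
Proof.
split=> [rb|-> a].
  apply/funext => v; rewrite [in LHS](coord_basis eb (memvf v)) rb.
  by rewrite mevalZ mevalX.
rewrite mevalZ mevalX; congr (_ * _).
by apply: eq_bigr => i _; rewrite coord_sum_basis.
Qed.

Lemma has_cdeg_posP (beta : V -> F) : has_cdeg beta n <->
  (exists u : {ffun 'I_n -> V}, defect beta u <> 0) /\
  (forall u : {ffun 'I_n.+1 -> V}, defect beta u = 0).
Proof.
split=> [[[_] //|[k [_ [<-] dn dn1]]]|[[u un0] dn1]].
  split=> [|u]; last by rewrite dn1.
  by apply/existsNP => dn0; apply: dn; apply/funext.
right; exists n; split=> //; last exact/funext.
by move=> dn; apply: un0; rewrite dn.
Qed.

Lemma reducedP (f : {mpoly F[d]}) : reduced f <-> {in msupp f, forall m, reduced_exponent F m}.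
Proof.
by split=> fr; [move=> m mf q Fq; apply: fr | move=> q Fq m mf; apply: fr].
Qed.

Lemma defect_scale k (c : F) (beta : V -> F) (u : {ffun 'I_k -> V}) :
  defect (fun v => c * beta v) u = c * defect beta u.
Proof.
by rewrite /defect mulr_sumr; apply: eq_bigr => I _; rewrite mulrCA.
Qed.

(** Every monomial of an n-application inherits homogeneity and multilinearity of
    the nth defect, so [multilinear_monomial] applies to those with nonzero nth
    defect; the others have combinatorial degree less than n. *)
Lemma applications_sub : (A_ V n `<=` Pt_ e n `&` Pequiv_ e n)%classic.
Proof.
move=> alpha [[ah _ al] ap].
have a0 : alpha 0 = 0 by rewrite -(scale0r 0) ah expr0n eqn0Ngt n0 mul0r.
have [f0 f0a] := (polynomial_mappingP _ eb).1 ap.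
have [f fr0 ff0] := reduce_mpoly f0.
have fa : realizes e f alpha by move=> a; rewrite ff0.
have fr : reduced f by apply/reducedP.
have m0 := monomial_mdeg_neq0 eb fr fa a0.
have mh := monomial_homogeneous eb fr fa ah.
have ml := monomial_defect_multilinear eb fr fa al.
have top m : m \in msupp f ->
    (exists u : {ffun 'I_n -> V}, defect (monomial e m) u <> 0) ->
    totally_reduced m /\ mdeg m = n.
  by move=> mf; apply: multilinear_monomial => //; [apply: m0|apply: fr0|apply: ml].
split.
  split.
    split=> //; apply/cdeg_leP => // u.
    move/realizesP : (fa) => ->//; rewrite defect_sum big1_seq // => m /andP[_ mf].
    have [/(top _ mf)[_ mn]|dm] := pselect
      (exists u : {ffun 'I_n -> V}, defect (monomial e m) u <> 0).
      by rewrite defect_monomial_gt ?mulr0 ?mn // -?mn ?m0 -?lt0n.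
    rewrite (@defect_eq0_leq _ _ n) ?mulr0 ?n0 //=; first exact: (monomial0 e (m0 _ mf)).
    by move=> v; apply: contrapT => dv; apply: dm; exists v.
  exists f; split=> // m beta mf /realizes_monomialP -> /has_cdeg_posP[[u +] _].
  rewrite defect_scale => du; apply: (top _ mf _).1; exists u => du0.
  by rewrite du0 mulr0 in du.
exists f; split=> // m beta mf _; split; first by apply/eqP/m0.
by apply/eqmod_exp; rewrite ?m0 -?lt0n //; apply: mh.
Qed.

(** Homogeneity comes from the degrees of the monomials.  For the nth defect,
    only the monomials of combinatorial degree n contribute; they are totally
    reduced, hence of degree n, hence have a multilinear nth defect. *)
Lemma sub_applications : (Pt_ e n `&` Pequiv_ e n `<=` A_ V n)%classic.
Proof.
move=> alpha [[[ap ac a0] [f [fr fa fQ]]] [g [gr ga gQ]]].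
split=> //; split.
- move=> a v; move/realizesP : (ga) => -> //; rewrite mulr_sumr.
  apply: eq_big_seq => m mg; rewrite monomialZ mulrCA.
  have [/eqP m0 /eqmod_exp -> //] : mdeg m <> 0%N /\ eqmod_card_minus1 F (mdeg m) n.
    apply: (gQ m (fun v => g@_m * monomial e m v)) => //.
    exact/realizes_monomialP.
  by rewrite -lt0n.
- exact: defect_symmetric.
have m0 := monomial_mdeg_neq0 eb fr fa a0.
have dn1 := monomial_defect_eq0 eb fr fa ((cdeg_leP _ a0).1 ac).
have ml m : m \in msupp f -> multilinear_form (@defect F V n (monomial e m)).
  move=> mf.
  have [dm|dm] := pselect
    (exists u : {ffun 'I_n -> V}, defect (monomial e m) u <> 0); last first.
    move=> i u a x y upd; have dz v : @defect F V n (monomial e m) v = 0.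
      by apply: contrapT => dv; apply: dm; exists v.
    by rewrite !dz mulr0 addr0.
  suff mr : totally_reduced m.
    by rewrite -(totally_reduced_mdeg eb (m0 _ mf) mr dm (dn1 _ mf));
       apply: monomial_multilinear => //; apply: m0.
  apply: (fQ m (fun v => f@_m * monomial e m v)) => //.
    exact/realizes_monomialP.
  apply/has_cdeg_posP; split; last by move=> u; rewrite defect_scale dn1 ?mulr0.
  have [u du] := dm; exists u; rewrite defect_scale; apply/eqP.
  by rewrite mulf_neq0 ?mcoeff_msupp -?mcoeff_msupp //; apply/eqP.
move=> i u a x y upd; move/realizesP : (fa) => -> //.
rewrite !defect_sum mulr_sumr -big_split; apply: eq_big_seq => m mf /=.
by rewrite (ml _ mf) mulrDr mulrCA.
Qed.

(** The nth defect of each monomial of [alpha] vanishes, so that no monomial has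
    combinatorial degree n. *)
Lemma P_pred_sub :
  (P_ V n.-1 `&` Pequiv_ e n `<=` Pt_ e n `&` Pequiv_ e n)%classic.
Proof.
move=> alpha [[ap ac a0] Ea]; split=> //.
have dn : forall u : {ffun 'I_n -> V}, defect alpha u = 0.
  by move/(cdeg_leP _ a0) : ac; rewrite prednK.
split; first split=> //.
  by apply/cdeg_leP => //; apply: (defect_eq0_leq (n := n)) => //; rewrite n0 /=.
have [f [fr fa _]] := Ea.
exists f; split=> // m beta mf /realizes_monomialP -> /has_cdeg_posP[[u +] _].
by rewrite defect_scale (monomial_defect_eq0 eb fr fa dn) ?mulr0.
Qed.

End Applications.

(** * Inverting polarization *)

Section Polarization.
Variables (F : fieldType) (V : vectType F).
Local Notation d := (\dim (fullv : {vspace V})).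
Variables (e : d.-tuple V) (eb : basis_of fullv e) (n : nat) (n0 : (0 < n)%N).
Implicit Types (j r : {ffun 'I_n -> 'I_d}) (phi : {ffun 'I_n -> V} -> F).

(** A choice of one sequence of indices for each monomial, so that a sum over
    monomials of degree n is a sum over the fixed points of [type_repr]. *)
Definition type_repr j := odflt j [pick r | index_type r == index_type j].

Lemma index_type_repr j : index_type (type_repr j) = index_type j.
Proof. by rewrite /type_repr; case: pickP => [r /eqP|]. Qed.

Lemma type_repr_eq j r : index_type j = index_type r -> type_repr j = type_repr r.
Proof.
move=> jr; rewrite /type_repr jr; case: pickP => // /(_ r); by rewrite eqxx.
Qed.

Lemma type_reprK j : type_repr (type_repr j) = type_repr j.
Proof. exact/type_repr_eq/index_type_repr. Qed.

(** The coefficient of a monomial is the value of [phi] at the matching basis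
    vectors divided by the order of the stabilizer, which is the value of the
    polarized monomial at these vectors.  When this order is zero in [F], the
    division returns zero. *)
Definition depolarize phi (v : V) : F :=
  \sum_(j | type_repr j == j)
    phi [ffun k => e`_(j k)] / #|index_stab j|%:R * coord_prod e j v.

Lemma depolarizeP (a : F) (phi psi : {ffun 'I_n -> V} -> F^o) v :
  depolarize (a *: phi + psi) v = a * depolarize phi v + depolarize psi v.
Proof.
rewrite /depolarize mulr_sumr -big_split; apply: eq_bigr => j _ /=.
by rewrite !mulrA -!mulrDl.
Qed.

Lemma defect_depolarize_sum phi k (u : {ffun 'I_k -> V}) :
  defect (depolarize phi) u = \sum_(j | type_repr j == j)
    phi [ffun k => e`_(j k)] / #|index_stab j|%:R * defect (coord_prod e j) u.
Proof.
rewrite -big_filter -(defect_sum _ _ (@coord_prod _ _ e n)).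
by congr (defect _ u); apply/funext => v; rewrite /depolarize -big_filter.
Qed.

Lemma depolarize_multilinear phi : multilinear_form (@defect F V n (depolarize phi)).
Proof.
move=> i u a x y upd; rewrite !defect_depolarize_sum mulr_sumr -big_split.
by apply: eq_bigr => j _ /=; rewrite coord_prod_multilinear // mulrDr mulrCA.
Qed.

Lemma depolarize_A phi : A_ V n (depolarize phi).
Proof.
split; last first.
  exists e; split=> //.
  exists (\sum_(j | type_repr j == j)
    (phi [ffun k => e`_(j k)] / #|index_stab j|%:R) *: 'X_[index_type j]) => a.
  rewrite raddf_sum; apply: eq_bigr => j _; rewrite coord_prodE /= mevalZ mevalX.
  by congr (_ * _); apply: eq_bigr => i _; rewrite coord_sum_basis.
split; [|exact: defect_symmetric|exact: depolarize_multilinear].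
move=> a v; rewrite /depolarize mulr_sumr; apply: eq_bigr => j _.
by rewrite coord_prodE monomialZ mdeg_index_type mulrCA.
Qed.

(** Both sides are multilinear and are compared at basis vectors
    [e_(r 0), ..., e_(r n.-1)].  Only the monomial of the type of [r]
    contributes.  If its stabilizer has order zero in [F], some basis vector is
    repeated p times and [phi] vanishes because it is characteristic. *)
Lemma defect_depolarize phi : characteristic_nlinear phi ->
  forall u, defect (depolarize phi) u = phi u.
Proof.
move=> [phis phil /characteristic_formP phic] u; apply/eqP; rewrite -subr_eq0; apply/eqP.
move: u; apply: (multilinear_basis_eq0 eb) => [i u a x y upd|r].
  rewrite depolarize_multilinear phil.
  by rewrite opprD addrACA mulrBr.
pose j := type_repr r.
have /index_type_eqP[s rs] : index_type r = index_type j by rewrite index_type_repr.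
have sym psi : Defs.symmetric_form psi ->
    psi [ffun k => e`_(r k)] = psi [ffun k => e`_(j k)].
  move=> psis; rewrite -[RHS](psis s); congr psi.
  by apply/ffunP => k; rewrite !ffunE rs.
rewrite (sym _ phis) (sym _ (@defect_symmetric _ _ _ _)) defect_depolarize_sum.
rewrite (bigD1 j) /=; last by rewrite type_reprK.
rewrite [X in _ + X - _]big1 => [|j' /andP[/eqP j'c jj']]; last first.
  rewrite defect_coord_prod_basis0 ?mulr0 // => t; apply: contrapT => tj.
  case/eqP: jj'; rewrite -j'c -[RHS](type_reprK r); apply: type_repr_eq.
  apply/index_type_eqP; exists t => k; apply: contrapT => tk.
  by apply: tj; exists k; apply/eqP.
rewrite defect_coord_prod_basis // addr0; have [G0|G0] := eqVneq (#|index_stab j|%:R : F) 0.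
  rewrite G0 mulr0 sub0r; apply/eqP; rewrite oppr_eq0; apply/eqP.
  have [p [i [pF pi]]] := index_stab_natr_eq0 G0.
  apply: (symmetric_repeat_eq0 (p := p) (x := e`_i) phis).
    apply: phic => //; rewrite (leq_trans pi) // -[n in (_ <= n)%N](mdeg_index_type j).
    by rewrite mdegE (bigD1 i) //= leq_addr.
  rewrite (leq_trans pi) // mnmE; apply/subset_leq_card/subsetP => k.
  by rewrite !inE ffunE => /eqP ->.
by rewrite divfK // subrr.
Qed.

Lemma defect_characteristic alpha : A_ V n alpha ->
  characteristic_nlinear (@defect F V n alpha).
Proof.
move=> [[ah as_ al] _]; split=> //; apply/characteristic_formP => p pF pn u v.
apply: defect_pchar_vanish => //.
by rewrite -(scale0r 0) ah expr0n eqn0Ngt n0 mul0r.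
Qed.

End Polarization.

(** * The quotient space and the isomorphism *)

Lemma inj_surj_bijective (T U : choiceType) (f : T -> U) :
  injective f -> (forall y, exists x, f x = y) -> bijective f.
Proof.
move=> finj /choice[g gK]; exists g => // x.
by apply: finj; rewrite gK.
Qed.

Section Quotient.
Local Open Scope quotient_scope.
Variables (F : fieldType) (E : lmodType F) (W U : subspace E).
Implicit Types (x y : subspace_type W).

Lemma pi_quotient_is_linear (a : F) x y :
  \pi_(quotient_space W U) (a *: x + y) =
  a *: \pi_(quotient_space W U) x + \pi_(quotient_space W U) y.
Proof. by rewrite -pi_quotient_spaceZ !piE. Qed.

Lemma pi_quotient_eq x y :
  \pi_(quotient_space W U) x = \pi_(quotient_space W U) y <->
  subspace_set U (val x - val y).
Proof.
rewrite -raddfB; apply: (iff_trans (rwP eqP)).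
rewrite -(Quotient.idealrBE (rel_pred U)); split=> [/asboolP|Uxy] //.
exact/asboolP.
Qed.

End Quotient.

(** Polarization separates n-applications exactly up to maps of combinatorial
    degree at most n - 1. *)
Lemma defect_eq_mod_P (F : fieldType) (V : vectType F)
    (e : (\dim (fullv : {vspace V})).-tuple V) (eb : basis_of fullv e)
    n (n0 : (0 < n)%N) (alpha beta : V -> F^o) :
  A_ V n alpha -> A_ V n beta ->
  subspace_set (subspaceI (P_ V n.-1) (Pequiv_ e n)) (alpha - beta) <->
  (forall u : {ffun 'I_n -> V}, defect alpha u = defect beta u).
Proof.
move=> Aa Ab; have dB (u : {ffun 'I_n -> V}) :
    defect (alpha - beta) u = defect alpha u - defect beta u.
  by rewrite addrC -scaleN1r defect_lin mulN1r addrC.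
have [[Pn _] Pe] : subspace_set (subspaceI (Pt_ e n) (Pequiv_ e n)) (alpha - beta).
  by rewrite addrC -scaleN1r; apply: subspaceP; apply: applications_sub.
have [ap _ a0] := Pn; split=> [[[_ c0 _] _] u|dab].
  have := (cdeg_leP _ a0).1 c0; rewrite prednK // => /(_ u) /eqP.
  by rewrite dB subr_eq0 => /eqP.
split=> //; split=> //; apply/cdeg_leP => //; rewrite prednK // => u.
by rewrite dB dab subrr.
Qed.

Local Open Scope classical_set_scope.
Local Open Scope ring_scope.

Theorem theorem6p1 (F : fieldType) (V : vectType F)
    (e : (\dim (fullv : {vspace V})).-tuple V) (eb : basis_of fullv e)
    (n : nat) (n_ge1 : (1 <= n)%N) :
  [/\ A_ V n = Pt_ e n `&` Pequiv_ e n,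
      P_ V n.-1 `&` Pequiv_ e n `<=` Pt_ e n `&` Pequiv_ e n
    & exists phi : {linear subspace_type (C_ V n) ->
          quotient_space (subspaceI (Pt_ e n) (Pequiv_ e n))
                         (subspaceI (P_ V n.-1) (Pequiv_ e n))},
        bijective phi].
Proof.
have AE : A_ V n = Pt_ e n `&` Pequiv_ e n.
  by apply/seteqP; split; [apply: applications_sub | apply: sub_applications].
split=> //; first exact: P_pred_sub.
set W := subspaceI _ _; set U := subspaceI _ _.
have WA x : subspace_set W x <-> A_ V n x by rewrite AE.
pose C := subspace_type (C_ V n).
have phiA (x : C) : A_ V n (depolarize e (val x)) by apply: depolarize_A.
have inW (x : C) : depolarize e (val x) \in subspace_pred W.
  exact/asboolP/WA/phiA.
pose f (x : C) := \pi_(quotient_space W U)%qT (SubspaceElt (inW x)).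
have flin : linear f.
  move=> a x y; rewrite /f -pi_quotient_is_linear; congr (\pi_(quotient_space W U)%qT _).
  by apply/val_inj/funext => v; rewrite /= depolarizeP.
have defE (x : C) u : defect (depolarize e (val x)) u = val x u.
  by apply: defect_depolarize => //; apply/asboolP/(valP x).
pose phi : {linear C -> quotient_space W U} :=
  HB.pack f (GRing.isLinear.Build F C (quotient_space W U) _ f flin).
exists phi; apply: inj_surj_bijective => [x x'|y].
  move=> /pi_quotient_eq/(defect_eq_mod_P eb n_ge1 (phiA x) (phiA x')) xx'.
  by apply/val_inj/funext => u; rewrite -!defE xx'.
pose w := generic_quotient.repr y; have wA : A_ V n (val w) by apply/WA/asboolP/(valP w).
have xC : (@defect F V n (val w) : _ -> F^o) \in subspace_pred (C_ V n).
  by apply/asboolP/defect_characteristic.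
exists (SubspaceElt xC); rewrite -[RHS]reprK.
by apply/pi_quotient_eq/(defect_eq_mod_P eb n_ge1 (phiA _) wA) => u; rewrite defE.
Qed.
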